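(* Let $G\subset GL(V)$ be a nontrivial irreducible finite real reflection group, $n=\dim_{\mathbb C}V$, with degrees $d_1\le\cdots\le d_n$, and let $(g,\zeta,q)$ be an admissible triplet. (i) Let $z^1,\dots,z^n$ be a $g$-homogeneous basis of $V^*$ with $I^*(z^\alpha,z^\beta)=\delta_{\alpha+\beta,n+1}$ for all $\alpha,\beta$, and let $x^1,\dots,x^n$ be a set of basic invariants that is good with respect to $(g,\zeta,q)$ and compatible with $z^1,\dots,z^n$. Let $J$ be the metric and $\circ$ the multiplication of the unique Saito--Dubrovin Frobenius structure $(J,\circ,e)$ on $\mathbb C[V]^G$ with unit $e=x^n(q)\frac{\partial}{\partial x^n}$. Then, writing $\frac{\partial}{\partial x^\alpha}\circ\frac{\partial}{\partial x^\beta}=\sum_{\gamma}C_{\alpha,\beta}^\gamma\frac{\partial}{\partial x^\gamma}$ and $\alpha*=n+1-\alpha$, for all $1\le\alpha,\beta,\gamma\le n$, $$J\left(\frac{\partial}{\partial x^\alpha},\frac{\partial}{\partial x^\beta}\right)=\delta_{\alpha+\beta,n+1},\qquad C_{\alpha,\beta}^{\gamma}=\frac{\partial}{\partial x^{\gamma*}}\left(\frac{d_n}{d_{\alpha*}+d_{\beta*}-2}I^*_G(dx^{\alpha*},dx^{\beta*})\right),$$ which are all written by the Taylor coefficients $\frac{\partial^a x^{\alpha}}{\partial z^a}(q)$ ($1\le\alpha\le n$, $a\in\mathbb Z_{\ge0}^n$, $d\cdot a=d_\alpha+d_n$) through the formula $$I^*_G(dx^{\alpha},dx^{\beta})=\delta_{\alpha+\beta,n+1}\frac{x^{n}}{x^{n}(q)}+\sum_{\substack{b\in\mathbb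 Z_{\ge0}^n,\ b_n=0,\\ d\cdot b=d_{\alpha}+d_{\beta}-2}}\frac{1}{b!}\left[\frac{\partial^b}{\partial z^b}\left(\frac{\partial x^{\alpha}}{\partial z^{\beta*}}+\frac{\partial x^{\beta}}{\partial z^{\alpha*}}\right)\right](q)\,x^b .$$ (ii) If a set of basic invariants is good with respect to an admissible triplet (a condition which does not depend on the choice of the admissible triplet), then it is flat with respect to the Saito--Dubrovin Frobenius structures. (iii) Equip $\mathrm{Spec}\,\mathbb C[V]$ with the metric induced by the dual metric $I^*$, and $\mathrm{Spec}\,\mathbb C[V]^G$ with the metric $J$ of (i). Then the $\mathbb C$-algebra isomorphism $\psi[g,\zeta,q]:\mathbb C[V]^G\to\mathbb C[V]$ gives an isometry with respect to these metrics; that is, $I^*(d\psi[g,\zeta,q](f_1),d\psi[g,\zeta,q](f_2))=\psi[g,\zeta,q](J^*(df_1,df_2))$ for all $f_1,f_2\in\mathbb C[V]^G$, where $J^*$ is the dual metric of $J$.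
   Context: Real reflection groups. $V$ is a complex vector space of dimension $n$; $G\subset GL(V)$ is a finite group generated by reflections of order 2 (a reflection is a finite-order element all but one of whose eigenvalues equal 1), there is a $G$-stable real subspace $V_{\mathbb R}\subset V$ with $V_{\mathbb R}\otimes_{\mathbb R}\mathbb C\to V$ bijective, and $V$ is an irreducible $G$-module. $\mathbb C[V]=\mathrm{Sym}(V^* )$ is the algebra of polynomial functions on $V$, with $(g\cdot F)(v)=F(g^{-1}v)$. A set of basic invariants is a set of algebraically independent homogeneous generators $x^1,\dots,x^n$ of $\mathbb C[V]^G$, indexed so that $\deg x^\alpha=d_\alpha$ with $d_1\le\cdots\le d_n$; the degrees depend only on $G$. Known facts: $d_1=2$, $d_{n-1}<d_n$, $d_\alpha+d_{n+1-\alpha}=d_n+2$. Multi-indices. For $b\in\mathbb Z_{\ge0}^n$: $d\cdot b=\sum_i d_ib_i$, $b!=\prod_i b_i!$, $x^b=\prod_i(x^i)^{b_i}$, $z^b=\prod_i(z^i)^{b_i}$, $\frac{\partial^b}{\partial z^b}=\prod_i(\partial/\partial z^i)^{b_i}$. Admissible triplet: $(g,\zeta,q)$ with $g\in G$, $\zeta\in\mathbb C$, $q\in V$, such that (1) $q$ is an eigenvector of $g$ with eigenvalue $\zeta$, a primitive $d_n$-th root of unity; (2) the Jacobian matrix $\left(\frac{\partial x^\alpha}{\partial z^\beta}(q)\right)$ is invertible for a basis $z^1,\dots,z^n$ of $V^*$. A $g$-homogeneous basis of $V^*$ is a basis with $g\cdot z^\alpha=\zeta^{d_\alpha-1}z^\alpha$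 for all $\alpha$ (it exists). For basic invariants one has $x^\alpha(q)=0$ for $\alpha<n$ and $x^n(q)\ne0$. Map $\psi$. For basic invariants $x^\alpha$ and a $g$-homogeneous basis $z^\alpha$, $\psi[g,\zeta,q]:\mathbb C[V]^G\to\mathbb C[V]$ is the $\mathbb C$-linear map $x^a\mapsto\sum_{d\cdot b=d\cdot a}\frac1{b!}\frac{\partial^b([x-x(q)]^a)}{\partial z^b}(q)z^b$, where $[x-x(q)]^a=\prod_i(x^i-x^i(q))^{a_i}$. It does not depend on the choices of $x^\alpha,z^\alpha$ and is a $\mathbb C$-algebra isomorphism. Good: basic invariants $x^1,\dots,x^n$ are good with respect to $(g,\zeta,q)$ if they form a $\mathbb C$-basis of $\psi[g,\zeta,q]^{-1}(V^* )$, where $V^*\subset\mathbb C[V]$ is the space of linear forms. Compatible with $z^1,\dots,z^n$: $\frac{\partial x^\alpha}{\partial z^\beta}(q)=\delta^\alpha_\beta$ for all $\alpha,\beta$. Bilinear forms. Fix a $G$-invariant positive definite symmetric $\mathbb R$-bilinear form on $V_{\mathbb R}$, extend it $\mathbb C$-bilinearly to $V$, and let $I^*:V^*\times V^*\to\mathbb C$ be the induced dual form, also extended $\mathbb C[V]$-bilinearly to $I^*:\Omega_{\mathbb C[V]}\otimes_{\mathbb C[V]}\Omega_{\mathbb C[V]}\to\mathbb C[V]$ (Kähler differentials over $\mathbb C$). It descends to the symmetric $\mathbb C[V]^G$-bilinear form $I^*_G:\Omega_{\mathbb C[V]^G}\otimes\Omega_{\mathbb C[V]^G}\to\mathbb C[V]^G$,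 $I^*_G(dx^\alpha,dx^\beta)=\sum_{\gamma_1,\gamma_2}\frac{\partial x^\alpha}{\partial z^{\gamma_1}}\frac{\partial x^\beta}{\partial z^{\gamma_2}}I^*(z^{\gamma_1},z^{\gamma_2})$. Saito--Dubrovin Frobenius structures. $Der(\mathbb C[V]^G)$ is the module of $\mathbb C$-derivations, graded so that $\frac{\partial}{\partial x^\alpha}$ has degree $-d_\alpha$; its lowest degree part $Der(\mathbb C[V]^G)(-d_n)$ is one-dimensional. The Euler field is $E=\sum_\alpha\frac{d_\alpha}{d_n}x^\alpha\frac{\partial}{\partial x^\alpha}$. A Saito--Dubrovin Frobenius structure is a triple $(J,\circ,e)$: a nondegenerate symmetric $\mathbb C[V]^G$-bilinear form $J$ on $Der(\mathbb C[V]^G)$ with values in $\mathbb C[V]^G$ (metric), a symmetric $\mathbb C[V]^G$-bilinear multiplication $\circ$ on $Der(\mathbb C[V]^G)$, and $e\in Der(\mathbb C[V]^G)$, such that, with $\nabla$ the Levi-Civita connection of $J$: (a) $J(X\circ Y,Z)=J(X,Y\circ Z)$; (b) $\nabla_X(Y\circ Z)-Y\circ\nabla_XZ-\nabla_Y(X\circ Z)+X\circ\nabla_YZ-[X,Y]\circ Z=0$ for all $X,Y,Z$; (c) $J$ is flat; (d) $e$ is the unit of $\circ$ and $\nabla e=0$; (e) $Lie_E(\circ)=\circ$ and $Lie_E(J)=\left(2-\frac{d_n-2}{d_n}\right)J$; (f) $J(E,J^*(\omega)\circ J^*(\omega'))=I^*_G(\omega,\omega')$ for all $\omega,\omega'\in\Omega_{\mathbb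 C[V]^G}$, where $J^*:\Omega_{\mathbb C[V]^G}\to Der(\mathbb C[V]^G)$ is the isomorphism induced by $J$. By a theorem of Saito and Dubrovin, such structures exist; $e\in Der(\mathbb C[V]^G)(-d_n)\setminus\{0\}$ always; for each nonzero $\widetilde e$ in this space there is exactly one such structure with unit $\widetilde e$; and any two differ by $(J,\circ,e)\mapsto(c^{-1}J,c^{-1}\circ,ce)$, $c\in\mathbb C^\times$. Hence $\nabla$ does not depend on the choice. A set of basic invariants is flat if $\nabla dx^\alpha=0$ for all $\alpha$. *)

(* Defs.v *)
From HB Require Import structures.
From mathcomp Require Import all_boot all_order all_algebra all_fingroup.
From mathcomp Require Import mxrepresentation sesquilinear.
From mathcomp Require Import boolp reals complex mpoly ring.
Set Implicit Arguments.
Unset Strict Implicit.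
Unset Printing Implicit Defensive.
Import Order.TTheory GRing.Theory Num.Theory.
Local Open Scope ring_scope.

Record derivation (K : fieldType) (A : comAlgType K) := Derivation {
  der_fun :> A -> A;
  der_linear : linear der_fun;
  der_leibniz : forall f h : A, der_fun (f * h) = f * der_fun h + h * der_fun f
}.

Section DerivationModule.
Context (K : fieldType) (A : comAlgType K).
Implicit Types (X Y Z : derivation A) (a b : A).

HB.instance Definition _ := gen_eqMixin (derivation A).
HB.instance Definition _ := gen_choiceMixin (derivation A).

Lemma derP X Y : (forall f, X f = Y f) -> X = Y.
Proof.
case: X Y => [u lu du] [v lv dv] /= /funext euv.
by move: lu du; rewrite euv => lu du; congr Derivation; exact: Prop_irrelevance.
Qed.

Lemma der_add_linear X Y : linear (fun f => X f + Y f).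
Proof. by move=> c f h; rewrite !der_linear scalerDr addrACA. Qed.
Lemma der_add_leibniz X Y f h :
  X (f * h) + Y (f * h) = f * (X h + Y h) + h * (X f + Y f).
Proof. by rewrite !der_leibniz !mulrDr addrACA. Qed.
Definition der_add X Y := Derivation (der_add_linear X Y) (@der_add_leibniz X Y).

Lemma der_opp_linear X : linear (fun f => - X f).
Proof. by move=> c f h; rewrite der_linear opprD scalerN. Qed.
Lemma der_opp_leibniz X f h : - X (f * h) = f * (- X h) + h * (- X f).
Proof. by rewrite der_leibniz opprD !mulrN. Qed.
Definition der_opp X := Derivation (der_opp_linear X) (@der_opp_leibniz X).

Lemma der_zero_linear : linear (fun _ : A => 0 : A).
Proof. by move=> c f h; rewrite scaler0 addr0. Qed.
Lemma der_zero_leibniz (f h : A) : 0 = f * 0 + h * 0.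
Proof. by rewrite !mulr0 addr0. Qed.
Definition der_zero := Derivation der_zero_linear der_zero_leibniz.

Lemma der_scale_linear a X : linear (fun f => a * X f).
Proof. by move=> c f h; rewrite der_linear mulrDr scalerAr. Qed.
Lemma der_scale_leibniz a X f h : a * X (f * h) = f * (a * X h) + h * (a * X f).
Proof. by rewrite der_leibniz mulrDr !(mulrCA a). Qed.
Definition der_scale a X :=
  Derivation (der_scale_linear a X) (@der_scale_leibniz a X).

Lemma der_addA : associative der_add.
Proof. by move=> X Y Z; apply: derP => f /=; rewrite addrA. Qed.
Lemma der_addC : commutative der_add.
Proof. by move=> X Y; apply: derP => f /=; rewrite addrC. Qed.
Lemma der_add0 : left_id der_zero der_add.
Proof. by move=> X; apply: derP => f /=; rewrite add0r. Qed.
Lemma der_addN : left_inverse der_zero der_opp der_add.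
Proof. by move=> X; apply: derP => f /=; rewrite addNr. Qed.
HB.instance Definition _ := GRing.isZmodule.Build (derivation A)
  der_addA der_addC der_add0 der_addN.

Lemma der_scaleA a b X : der_scale a (der_scale b X) = der_scale (a * b) X.
Proof. by apply: derP => f /=; rewrite mulrA. Qed.
Lemma der_scale1 : left_id 1 der_scale.
Proof. by move=> X; apply: derP => f /=; rewrite mul1r. Qed.
Lemma der_scaleDr : right_distributive der_scale +%R.
Proof. by move=> a X Y; apply: derP => f /=; rewrite mulrDr. Qed.
Lemma der_scaleDl X : {morph der_scale^~ X : a b / a + b}.
Proof. by move=> a b; apply: derP => f /=; rewrite mulrDl. Qed.
HB.instance Definition _ := GRing.Zmodule_isLmodule.Build A (derivation A)
  der_scaleA der_scale1 der_scaleDr der_scaleDl.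

Lemma lie_linear X Y : linear (fun f => X (Y f) - Y (X f)).
Proof.
by move=> c f h; rewrite !der_linear scalerBr opprD addrACA.
Qed.
Lemma lie_leibniz X Y f h :
  X (Y (f * h)) - Y (X (f * h)) =
  f * (X (Y h) - Y (X h)) + h * (X (Y f) - Y (X f)).
Proof.
have addX (W : derivation A) (u v : A) : W (u + v) = W u + W v.
  by have := der_linear W 1 u v; rewrite !scale1r.
by rewrite !(der_leibniz, addX); ring.
Qed.
Definition lie X Y := Derivation (lie_linear X Y) (@lie_leibniz X Y).

End DerivationModule.

Section KahlerMetric.
Context (K : fieldType) (A : comAlgType K).
Implicit Types (X Y Z : derivation A).

(* The list [:: (a1, f1); ..; (ak, fk)] represents \sum_i ai dfi in Omega_A;
   different lists may represent the same differential, and everything below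
   depends on a list only through the differential it represents. *)
Definition kahler := seq (A * A).
Definition kd (f : A) : kahler := [:: (1, f)].
Definition pairing (w : kahler) X : A := \sum_(p <- w) p.1 * X p.2.

(* Nondegeneracy: X |-> J(X, .) is an isomorphism from Der(A) onto Omega_A. *)
Record metric := Metric {
  metric_form :> {bilinear derivation A -> derivation A -> A | *%R & *%R};
  metric_sym : forall X Y, metric_form X Y = metric_form Y X;
  metric_nondeg : forall w : kahler,
    exists! X, forall Y, metric_form X Y = pairing w Y
}.

Definition sharp (J : metric) (w : kahler) : derivation A :=
  projT1 (cid (metric_nondeg J w)).

Definition dual_metric (J : metric) (w w' : kahler) : A :=
  J (sharp J w) (sharp J w').

Record is_levi_civita (J : metric)
    (nabla : derivation A -> derivation A -> derivation A) : Prop := {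
  nabla_linear : forall Y, linear (nabla^~ Y);
  nablaD : forall X Y Z, nabla X (Y + Z) = nabla X Y + nabla X Z;
  nabla_leibniz : forall X (f : A) Y,
    nabla X (f *: Y) = X f *: Y + f *: nabla X Y;
  nabla_torsion_free : forall X Y, nabla X Y - nabla Y X = lie X Y;
  nabla_metric : forall X Y Z,
    X (J Y Z) = J (nabla X Y) Z + J Y (nabla X Z)
}.

Definition curvature (nabla : derivation A -> derivation A -> derivation A)
    X Y Z : derivation A :=
  nabla X (nabla Y Z) - nabla Y (nabla X Z) - nabla (lie X Y) Z.

(* (nabla_X w)(Y) for the connection induced on Omega_A. *)
Definition nabla_form (nabla : derivation A -> derivation A -> derivation A)
    X (w : kahler) Y : A :=
  X (pairing w Y) - pairing w (nabla X Y).

End KahlerMetric.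

Section Coordinates.
Context (K : fieldType) (A : comAlgType K) (n : nat).

Definition poly_eval (x : 'I_n -> A) (P : {mpoly K[n]}) : A :=
  mmap (in_alg A) x P.

Record coordinates := Coordinates {
  coord :> 'I_n -> A;
  coord_alg_indep : forall P, poly_eval coord P = 0 -> P = 0;
  coord_generate : forall f, exists P, poly_eval coord P = f
}.

Variable x : coordinates.

Definition coord_poly (f : A) : {mpoly K[n]} :=
  projT1 (cid (coord_generate x f)).

Lemma coord_polyK f : poly_eval x (coord_poly f) = f.
Proof. exact: projT2 (cid (coord_generate x f)). Qed.

Lemma poly_evalD P Q : poly_eval x (P + Q) = poly_eval x P + poly_eval x Q.
Proof. exact: raddfD. Qed.

Lemma poly_evalZ c P : poly_eval x (c *: P) = c *: poly_eval x P.
Proof. by rewrite /poly_eval mmapZ /= mulr_algl. Qed.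

Lemma poly_evalM P Q : poly_eval x (P * Q) = poly_eval x P * poly_eval x Q.
Proof. exact: rmorphM. Qed.

Lemma poly_eval_inj : injective (poly_eval x).
Proof.
move=> P Q /eqP; rewrite -subr_eq0 -[- poly_eval x Q]scaleN1r -poly_evalZ.
rewrite -poly_evalD => /eqP/coord_alg_indep/eqP.
by rewrite scaleN1r subr_eq0 => /eqP.
Qed.

Lemma pdx_linear (i : 'I_n) :
  linear (fun f => poly_eval x (mderiv i (coord_poly f))).
Proof.
move=> c f h; rewrite -poly_evalZ -poly_evalD -mderivZ -mderivD.
congr (poly_eval x (mderiv i _)); apply: poly_eval_inj.
by rewrite poly_evalD poly_evalZ !coord_polyK.
Qed.

Lemma pdx_leibniz (i : 'I_n) (f h : A) :
  poly_eval x (mderiv i (coord_poly (f * h))) =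
  f * poly_eval x (mderiv i (coord_poly h)) +
  h * poly_eval x (mderiv i (coord_poly f)).
Proof.
have -> : coord_poly (f * h) = coord_poly f * coord_poly h.
  by apply: poly_eval_inj; rewrite poly_evalM !coord_polyK.
rewrite mderivM poly_evalD !poly_evalM !coord_polyK addrC.
by congr (_ + _); rewrite mulrC.
Qed.

Definition pdx (i : 'I_n) : derivation A :=
  Derivation (pdx_linear i) (@pdx_leibniz i).

End Coordinates.

Section LinearForms.
Context (C : fieldType) (n : nat).
Implicit Types (f h : {mpoly C[n]}) (A B Z : 'M[C]_n) (q : 'rV[C]_n).
Implicit Types (d : 'I_n -> nat) (b : 'X_{1..n}).

Definition ev q f : C := f.@[fun i => q 0 i].

(* v |-> f (v *m A) *)
Definition linsubst A f : {mpoly C[n]} :=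
  f \mPo [tuple \sum_j A j i *: 'X_j | i < n].

(* A basis z^1, .., z^n of the dual space V^* is given by an invertible matrix
   Z, whose a-th row lists the coefficients of z^a. *)
Definition zform Z (a : 'I_n) : {mpoly C[n]} := \sum_i Z a i *: 'X_i.

Definition dz Z (a : 'I_n) f : {mpoly C[n]} :=
  \sum_i invmx Z i a *: f^`M(i).

Definition dzm Z b f : {mpoly C[n]} :=
  foldr (fun a => iter (b a) (dz Z a)) f (enum 'I_n).

Definition wdeg d b : nat := (\sum_i d i * b i)%N.

Definition mnm_fact b : nat := (\prod_i (b i)`!)%N.

Definition bilin B (u v : 'rV[C]_n) : C := (u *m B *m v^T) 0 0.

(* The form on V^* induced by a symmetric nondegenerate form B on V: the
   linear form v |-> B(u, v) has coefficient vector u *m B. *)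
Definition dual_form B (phi psi : 'rV[C]_n) : C :=
  bilin B (phi *m invmx B) (psi *m invmx B).

(* I^*(df, dh) *)
Definition Istar B f h : {mpoly C[n]} :=
  \sum_i \sum_j
    dual_form B (delta_mx 0 i) (delta_mx 0 j) *: (f^`M(i) * h^`M(j)).

End LinearForms.

Section LinearSubstitution.
Context (C : fieldType) (n : nat).
Implicit Types (f h : {mpoly C[n]}) (A B : 'M[C]_n).

Lemma linsubst_mderiv A f j :
  (linsubst A f)^`M(j) = \sum_i A j i *: linsubst A (f^`M(i)).
Proof.
pose s := [tuple \sum_j A j i *: 'X_j | i < n] : n.-tuple {mpoly C[n]}.
pose P f := (f \mPo s)^`M(j) = \sum_i A j i *: (f^`M(i) \mPo s).
rewrite -/(P f).
have PD f1 f2 : P f1 -> P f2 -> P (f1 + f2).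
  rewrite /P comp_mpolyD mderivD => -> ->; rewrite -big_split /=.
  by apply: eq_bigr => i _; rewrite mderivD comp_mpolyD scalerDr.
have PZ c f1 : P f1 -> P (c *: f1).
  rewrite /P comp_mpolyZ mderivZ => ->; rewrite scaler_sumr.
  by apply: eq_bigr => i _; rewrite mderivZ comp_mpolyZ !scalerA mulrC.
have PM f1 f2 : P f1 -> P f2 -> P (f1 * f2).
  rewrite /P (rmorphM (comp_mpoly s)) mderivM => -> ->.
  rewrite mulr_suml mulr_sumr -big_split /=.
  apply: eq_bigr => i _; rewrite mderivM comp_mpolyD !(rmorphM (comp_mpoly s)).
  by rewrite scalerDr scalerAl scalerAr.
have PC c : P c%:MP.
  rewrite /P comp_mpolyC mderivC big1 // => i _.
  by rewrite mderivC comp_mpoly0 scaler0.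
have PX i : P 'X_i.
  rewrite /P comp_mpolyXU -tnth_nth tnth_mktuple raddf_sum /=.
  rewrite (bigD1 j) //= [X in _ + X]big1 ?addr0 => [|k nkj]; last first.
    by rewrite mderivZ mderivX mnm1E (negPf nkj) scale0r scaler0.
  rewrite (bigD1 i) //= [X in _ + X]big1 ?addr0 => [|k nki]; last first.
    by rewrite mderivX mnm1E eq_sym (negPf nki) scale0r comp_mpoly0 scaler0.
  have subU k : (U_(k) - U_(k) = 0 :> 'X_{1..n})%MM.
    by apply/mnmP => l; rewrite mnmBE subnn mnm0E.
  rewrite mderivZ !mderivX !mnm1E !eqxx !subU mpolyX0 !scale1r.
  by rewrite comp_mpoly1.
elim/mpolyind: f => [|c m p _ _ IHp]; first by rewrite -mpolyC0; apply: PC.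
apply: PD IHp; apply: PZ; rewrite mpolyXE_id.
elim/big_ind: _ => [|p1 p2 h1 h2|i _]; first by rewrite -mpolyC1; apply: PC.
  exact: PM.
elim: (m i) => [|k IHk]; first by rewrite expr0 -mpolyC1; apply: PC.
by rewrite exprS; apply: PM.
Qed.

Lemma bilin_delta B i j : bilin B (delta_mx 0 i) (delta_mx 0 j) = B i j.
Proof. by rewrite /bilin -rowE trmx_delta -colE !mxE. Qed.

Lemma bilin_symP B : (forall u v, bilin B u v = bilin B v u) -> B^T = B.
Proof. by move=> sB; apply/matrixP => i j; rewrite mxE -!bilin_delta sB. Qed.

Lemma dual_form_delta B i j : B^T = B -> B \in unitmx ->
  dual_form B (delta_mx 0 i) (delta_mx 0 j) = invmx B i j.
Proof.
move=> sB uB; rewrite /dual_form /bilin mulmxKV // trmx_mul trmx_inv sB.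
by rewrite mulmxA -bilin_delta.
Qed.

Lemma invmx_inv A B : B \in unitmx -> A *m B *m A^T = B ->
  A^T *m invmx B *m A = invmx B.
Proof.
move=> uB invB.
have /andP[/andP[uA _] uAt] : (A \in unitmx) && (B \in unitmx) && (A^T \in unitmx).
  by rewrite -!unitmx_mul invB.
have BA : B *m A^T = invmx A *m B.
  by rewrite -{2}invB !mulmxA mulVmx // mul1mx.
rewrite -[LHS](mulKmx uB) 2!(mulmxA B) BA -(mulmxA (invmx A)) mulmxV // mulmx1.
by rewrite mulVmx // mulmx1.
Qed.

Definition gradient f : 'rV[{mpoly C[n]}]_n := \row_i f^`M(i).

Lemma IstarE B f h : B^T = B -> B \in unitmx ->
  Istar B f h =
  (gradient f *m map_mx (@mpolyC n C) (invmx B) *m (gradient h)^T) 0 0.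
Proof.
move=> sB uB; rewrite /Istar exchange_big /= mxE; apply: eq_bigr => j _.
rewrite !mxE mulr_suml; apply: eq_bigr => i _.
by rewrite dual_form_delta // !mxE -mul_mpolyC mulrA [_%:MP * _]mulrC.
Qed.

Lemma gradient_linsubst A f : gradient (linsubst A f) =
  map_mx (linsubst A) (gradient f) *m (map_mx (@mpolyC n C) A)^T.
Proof.
apply/rowP => j; rewrite !mxE linsubst_mderiv; apply: eq_bigr => i _.
by rewrite !mxE -mul_mpolyC mulrC.
Qed.

Lemma linsubst_Istar A B f h : B^T = B -> B \in unitmx ->
  A *m B *m A^T = B -> linsubst A f = f -> linsubst A h = h ->
  linsubst A (Istar B f h) = Istar B f h.
Proof.
move=> sB uB invB hf hh.
pose s := [tuple \sum_j A j i *: 'X_j | i < n] : n.-tuple {mpoly C[n]}.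
rewrite [RHS]IstarE // -{2}hf -{2}hh !gradient_linsubst.
rewrite trmx_mul trmxK; set M := map_mx _ A; set N := map_mx _ (invmx B).
have MN : M^T *m N *m M = N.
  by rewrite /M /N -[in RHS](invmx_inv uB invB) !map_mxM matrix.map_trmx.
rewrite mulmxA -(mulmxA (map_mx _ _)) -(mulmxA (map_mx _ _)) MN IstarE // -/N.
have sN : map_mx (comp_mpoly s) N = N.
  by apply/matrixP => i j; rewrite !mxE comp_mpolyC.
by rewrite -[in RHS]sN matrix.map_trmx -!map_mxM [RHS]mxE.
Qed.

End LinearSubstitution.

(* V is the space 'rV[C]_n of row vectors with C = R[i]; as usual for
   mx_representation, g acts on V by the operator v |-> v *m rG g.  A
   polynomial function on V is a polynomial in the n coordinates. *)

Section ReflectionGroup.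
Context (R : realType) (gT : finGroupType) (G : {group gT}) (n : nat).
Local Notation C := (R[i]).
Context (rG : mx_representation C G n).

(* All but one of the eigenvalues (with multiplicity) are equal to 1; the
   elements of G have finite order. *)
Definition reflection (g : gT) : Prop :=
  exists2 c : C, c != 1 &
    char_poly (rG g) = ('X - 1%:P) ^+ n.-1 * ('X - c%:P).

Definition generated_by_reflections : Prop :=
  G :=: <<[set g in G | `[< reflection g >] & #[g]%g == 2]>>%g.

(* A G-stable real form of V; the last field says that the map from
   V_R (x) C = V_R (+) i V_R to V is bijective. *)
Record real_form := RealForm {
  rf_mem :> 'rV[C]_n -> Prop;
  rf0 : rf_mem 0;
  rfD : forall u v, rf_mem u -> rf_mem v -> rf_mem (u + v);
  rfZ : forall (r : R) v, rf_mem v -> rf_mem (r%:C%C *: v);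
  rf_stable : forall g v, g \in G -> rf_mem v -> rf_mem (v *m rG g);
  rf_bij : forall v, exists! p : 'rV[C]_n * 'rV[C]_n,
    [/\ rf_mem p.1, rf_mem p.2 & v = p.1 + 'i%C *: p.2]
}.

(* The C-bilinear extension to V of a G-invariant positive definite symmetric
   R-bilinear form on V_R, given by its Gram matrix. *)
Record invariant_form (VR : real_form) := InvariantForm {
  gram :> 'M[C]_n;
  gram_sym : forall u v, bilin gram u v = bilin gram v u;
  gram_real : forall u v, VR u -> VR v -> bilin gram u v \is Num.real;
  gram_pos : forall v, VR v -> v != 0 -> 0 < bilin gram v v;
  gram_inv : forall g u v, g \in G ->
    bilin gram (u *m rG g) (v *m rG g) = bilin gram u v
}.

(* (g . F)(v) = F (g^-1 v) *)
Definition gact (g : gT) (F : {mpoly C[n]}) : {mpoly C[n]} :=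
  linsubst (rG g^-1%g) F.

Definition inv_pred : {pred {mpoly C[n]}} :=
  fun F => [forall g in G, gact g F == F].

Lemma inv_predP F : reflect (forall g, g \in G -> gact g F = F) (F \in inv_pred).
Proof.
by apply: (iffP forall_inP) => h g gG; apply/eqP; [exact: h | rewrite h].
Qed.

Lemma inv_subalg_closed : subalg_closed inv_pred.
Proof.
split=> [|c F H /inv_predP hF /inv_predP hH|F H /inv_predP hF /inv_predP hH];
  apply/inv_predP => g gG; rewrite /gact /linsubst.
- exact: comp_mpoly1.
- by rewrite linearP; congr (_ *: _ + _); [exact: hF | exact: hH].
- by rewrite rmorphM; congr (_ * _); [exact: hF | exact: hH].
Qed.
HB.instance Definition _ :=
  GRing.isSubalgClosed.Build C {mpoly C[n]} inv_pred inv_subalg_closed.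

Record invariants := Invariant {
  inv_val :> {mpoly C[n]};
  _ : inv_val \in inv_pred
}.
HB.instance Definition _ := [isSub for inv_val].
HB.instance Definition _ := [Choice of invariants by <:].
HB.instance Definition _ := [SubChoice_isSubComNzRing of invariants by <:].
HB.instance Definition _ := [SubZmodule_isSubLmodule of invariants by <:].
HB.instance Definition _ :=
  [SubNzRing_SubLmodule_isSubLalgebra of invariants by <:].
HB.instance Definition _ := [SubLalgebra_isSubAlgebra of invariants by <:].

Section InvariantForm.
Context (VR : real_form) (I : invariant_form VR).

Lemma gram_trmx : (I : 'M[C]_n)^T = I.
Proof. exact/bilin_symP/gram_sym. Qed.

Lemma gram_unit : (I : 'M[C]_n) \in unitmx.
Proof.
rewrite -row_free_unit; apply/inj_row_free => u uI0.
have [[a b] /= [[ha hb Du] _]] := rf_bij VR u.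
have bil0 w : bilin I a w + 'i%C * bilin I b w = 0.
  have : bilin I u w = 0 by rewrite /bilin uI0 mul0mx mxE.
  by rewrite Du /bilin !mulmxDl -!scalemxAl !mxE.
have real0 x y : x \is Num.real -> y \is Num.real ->
    x + 'i%C * y = 0 -> x = 0 /\ y = 0 :> C.
  move=> /complex_realP[s ->] /complex_realP[t ->].
  by move=> /eqP; rewrite eq_complex /= !(mul0r, mulr0, mul1r, subr0, addr0, add0r) => /andP[/eqP-> /eqP->].
have a0 : a = 0.
  apply/eqP; apply: contraT => na; have := gram_pos I ha na.
  by have [-> _] := real0 _ _ (gram_real I ha ha) (gram_real I hb ha) (bil0 a);
    rewrite ltxx.
have b0 : b = 0.
  apply/eqP; apply: contraT => nb; have := gram_pos I hb nb.
  by have [_ ->] := real0 _ _ (gram_real I ha hb) (gram_real I hb hb) (bil0 b);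
    rewrite ltxx.
by rewrite Du a0 b0 scaler0 addr0.
Qed.

Lemma Istar_inv (f h : invariants) : Istar I f h \in inv_pred.
Proof.
apply/inv_predP => g gG.
have fixP (k : invariants) : linsubst (rG g^-1%g) k = k.
  by case: k => k /= /inv_predP /(_ _ gG).
apply: linsubst_Istar (fixP f) (fixP h); [exact: gram_trmx|exact: gram_unit|].
apply/matrixP => i j; rewrite -!bilin_delta -(gram_inv I _ _ (groupVr gG)).
by rewrite /bilin trmx_mul !mulmxA.
Qed.

Definition IstarG (f h : invariants) : invariants := Invariant (Istar_inv f h).

Definition IstarG_form (w w' : kahler invariants) : invariants :=
  \sum_(p <- w) \sum_(p' <- w') p.1 * p'.1 * IstarG p.2 p'.2.

End InvariantForm.
End ReflectionGroup.

(* From here on dim V = n.+1; indices are 0-based, so that ord_max is the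
   index n of the mathematics and rev_ord a is a* = n + 1 - a. *)

Section GoodInvariants.
Context (R : realType) (gT : finGroupType) (G : {group gT}) (n : nat).
Local Notation C := (R[i]).
Context (rG : mx_representation C G n.+1).
Local Notation S := (invariants rG).
Implicit Types (Z : 'M[C]_n.+1) (q : 'rV[C]_n.+1) (g : gT) (zeta : C).

Record basic_invariants (d : 'I_n.+1 -> nat) := BasicInvariants {
  basic_coord :> coordinates S n.+1;
  basic_homog : forall a, inv_val (basic_coord a) \is (d a).-homog;
  basic_sorted : forall a b : 'I_n.+1, (a <= b -> d a <= d b)%N
}.

Section Degrees.
Context (d : 'I_n.+1 -> nat).
Implicit Types (x y : basic_invariants d).

Record admissible g zeta q : Prop := {
  adm_group : g \in G;
  adm_neq0 : q != 0;
  adm_eigen : q *m rG g = zeta *: q;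
  adm_root : (d ord_max).-primitive_root zeta;
  adm_jacobian : exists x, exists2 Z, Z \in unitmx &
    \matrix_(a, b) ev q (dz Z b (x a)) \in unitmx
}.

Definition g_homogeneous g zeta Z : Prop :=
  Z \in unitmx /\
  forall a, gact rG g (zform Z a) = zeta ^+ (d a - 1) *: zform Z a.

(* The image of the monomial x^a.  The d i are degrees of basic invariants, hence
   positive, so the bound on mdeg b excludes no b with d . b = d . a. *)
Definition psi_monomial x Z q (a : 'X_{1..n.+1}) : {mpoly C[n.+1]} :=
  \sum_(b : 'X_{1..n.+1 < (wdeg d a).+1} | wdeg d b == wdeg d a)
    ((mnm_fact b)%:R^-1 *
     ev q (dzm Z b (\prod_i (inv_val (x i) - (ev q (x i))%:MP) ^+ a i)))
    *: \prod_i zform Z i ^+ b i.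

Definition psi x Z q (f : S) : {mpoly C[n.+1]} :=
  \sum_(a <- msupp (coord_poly x f)) (coord_poly x f)@_a *: psi_monomial x Z q a.

(* x is a C-basis of the preimage of V^* under psi; psi does not depend on the
   basic invariants y and the g-homogeneous basis Z used to write it. *)
Definition good x g zeta q : Prop :=
  exists y, exists2 Z, g_homogeneous g zeta Z &
    (forall a, psi y Z q (x a) \is 1.-homog) /\
    (forall f, psi y Z q f \is 1.-homog ->
       exists! c : 'rV[C]_n.+1, f = \sum_a c 0 a *: x a).

Definition compatible x Z q : Prop :=
  forall a b, ev q (dz Z b (x a)) = (a == b)%:R.

Definition euler x : derivation S :=
  \sum_a (((d a)%:R / (d ord_max)%:R) *: x a) *: pdx x a.

(* Saito-Dubrovin Frobenius structures (J, o, e); sd_nabla is the Levi-Civita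
   connection, which is determined by J, and euler x does not depend on x. *)
Record saito_dubrovin (VR : real_form rG) (I : invariant_form VR) x :=
  SaitoDubrovin {
  sd_metric : metric S;
  sd_mul : {bilinear derivation S -> derivation S -> derivation S};
  sd_unit : derivation S;
  sd_nabla : derivation S -> derivation S -> derivation S;
  sd_levi_civita : is_levi_civita sd_metric sd_nabla;
  sd_mulC : forall X Y, sd_mul X Y = sd_mul Y X;
  sd_invariance : forall X Y Z : derivation S,
    sd_metric (sd_mul X Y) Z = sd_metric X (sd_mul Y Z);
  sd_potential : forall X Y Z : derivation S,
    sd_nabla X (sd_mul Y Z) - sd_mul Y (sd_nabla X Z)
    - sd_nabla Y (sd_mul X Z) + sd_mul X (sd_nabla Y Z)
    - sd_mul (lie X Y) Z = 0;
  sd_flat : forall X Y Z : derivation S, curvature sd_nabla X Y Z = 0;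
  sd_unitP : forall X, sd_mul sd_unit X = X;
  sd_unit_flat : forall X, sd_nabla X sd_unit = 0;
  sd_euler_mul : forall X Y,
    lie (euler x) (sd_mul X Y) - sd_mul (lie (euler x) X) Y
    - sd_mul X (lie (euler x) Y) = sd_mul X Y;
  sd_euler_metric : forall X Y,
    euler x (sd_metric X Y) - sd_metric (lie (euler x) X) Y
    - sd_metric X (lie (euler x) Y) =
    (2 - ((d ord_max)%:R - 2) / (d ord_max)%:R : C) *: sd_metric X Y;
  sd_intersection : forall w w' : kahler S,
    sd_metric (euler x) (sd_mul (sharp sd_metric w) (sharp sd_metric w')) =
    IstarG_form I w w'
}.

Definition flat_invariants (VR : real_form rG) (I : invariant_form VR) x
    (F : saito_dubrovin I x) : Prop :=
  forall a X Y, nabla_form (sd_nabla F) X (kd (x a)) Y = 0.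

End Degrees.
End GoodInvariants.

(* Main.v *)
Require Import Defs.
From HB Require Import structures.
From mathcomp Require Import all_boot all_order all_algebra all_fingroup.
From mathcomp Require Import mxrepresentation sesquilinear.
From mathcomp Require Import boolp reals complex mpoly ring zify.
Set Implicit Arguments.
Unset Strict Implicit.
Unset Printing Implicit Defensive.
Import Order.TTheory GRing.Theory Num.Theory.
Local Open Scope ring_scope.

(* Expand invariants at q in a g-homogeneous basis z, with z^i in weight d_i.
   Homogeneity and g-invariance leave in x^a - x^a(q) only the weights
   d_a + k d_n, and psi is the passage to the parts of lowest weight.  The
   polynomial P with P(x) = I^*_G(dx^a, dx^b) has weight d_a + d_b - 2 < 2 d_n,
     so
   it is affine in x^n.  Comparing in P(x) = I^*(dx^a, dx^b) the terms of weight
   d_a + d_b - 2 - d_n gives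
     x^n(q) psi(dP/dx^n) = I^*(d psi(x^a), d psi(x^b)),
   and, when psi(x^a) = z^a, the terms of weight d_a + d_b - 2 give the formula
   for I^*_G.  The axioms of a Saito-Dubrovin structure imply
   J^*(dx^a, dx^b) = e(I^*_G(dx^a, dx^b)) with e a multiple of d/dx^n, so the
   displayed identity says that psi is an isometry.  A polynomial change of
   coordinates with constant Gram matrix is affine; hence x is good exactly when
   all the dP/dx^n are constant, and then the Christoffel symbols of J vanish.
     *)

(** * Polynomial substitution and derivations *)

(** The obstacle is that x^n(q) is nonzero: the expansion of x^n starts in weight 0 instead of d_n,
    so substituting expansions into P does not respect weights. Since x^n has exponent at most one
    in P, its value at q creates exactly one lower layer, d_n below, equal to x^n(q) times dP/dx^n
    at the leading parts. On the metric side I^*(z^i, z^j) is nonzero only for d_i + d_j = d_n + 2,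
    so the two derivatives together lower the weight by d_n + 2 and the leading parts meet that same
    layer. That x^n is the only invariant with a value at q rests on d_a < d_n for a < n. This
    strict inequality and the duality of degrees are derived here from the triplet: the g-invariance
    of I^* forces the pairing of degrees, and Schur's lemma makes the invariant of degree 2 unique.
    One symmetry argument serves twice: a three-index tensor that is symmetric in one pair of
    neighbouring indices and antisymmetric in the other vanishes. It kills the second derivatives of
    the leading parts, and later the Christoffel symbols of J. *)

Section MderivDerivation.
Context (K : fieldType) (n : nat).

Lemma mderiv_lin (i : 'I_n) : linear (fun P : {mpoly K[n]} => P^`M(i)).
Proof. by move=> c P Q; rewrite linearP. Qed.

Lemma mderiv_leib (i : 'I_n) (P Q : {mpoly K[n]}) :
  (P * Q)^`M(i) = P * Q^`M(i) + Q * P^`M(i).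
Proof. by rewrite mderivM addrC (mulrC _ Q). Qed.

Definition mder (i : 'I_n) : derivation {mpoly K[n]} :=
  Derivation (mderiv_lin i) (@mderiv_leib i).

End MderivDerivation.
Arguments mder {K n}.

Section PolyEval.
Context (K : fieldType) (n : nat).
Implicit Types (P Q : {mpoly K[n]}).

Lemma poly_eval_additive (A : comAlgType K) (x : 'I_n -> A) :
  additive (poly_eval x).
Proof. exact: mmap_is_additive. Qed.

Lemma poly_eval_multiplicative (A : comAlgType K) (x : 'I_n -> A) :
  multiplicative (poly_eval x).
Proof. exact: mmap_is_multiplicative. Qed.

Lemma poly_eval_scalable (A : comAlgType K) (x : 'I_n -> A) :
  scalable (poly_eval x).
Proof. by move=> c P; rewrite /poly_eval mmapZ mulr_algl. Qed.

HB.instance Definition _ (A : comAlgType K) (x : 'I_n -> A) :=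
  GRing.isAdditive.Build {mpoly K[n]} A (poly_eval x) (poly_eval_additive x).
HB.instance Definition _ (A : comAlgType K) (x : 'I_n -> A) :=
  GRing.isMultiplicative.Build {mpoly K[n]} A (poly_eval x)
    (poly_eval_multiplicative x).
HB.instance Definition _ (A : comAlgType K) (x : 'I_n -> A) :=
  GRing.isScalable.Build K {mpoly K[n]} A *:%R (poly_eval x)
    (poly_eval_scalable x).

Section Basics.
Context (A : comAlgType K) (x : 'I_n -> A).

Lemma poly_evalC c : poly_eval x c%:MP = c%:A.
Proof. by rewrite /poly_eval mmapC. Qed.

Lemma poly_evalXm m : poly_eval x 'X_[m] = \prod_i x i ^+ m i.
Proof. by rewrite /poly_eval mmapX. Qed.

Lemma poly_evalX i : poly_eval x 'X_i = x i.
Proof. by rewrite /poly_eval mmapX mmap1U. Qed.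

Lemma poly_evalE P :
  poly_eval x P = \sum_(m <- msupp P) P@_m *: \prod_i x i ^+ m i.
Proof. by apply: eq_bigr => m _; rewrite mulr_algl. Qed.

End Basics.

Lemma poly_eval_morph (A B : comAlgType K) (f : {lrmorphism A -> B})
    (x : 'I_n -> A) P : f (poly_eval x P) = poly_eval (f \o x) P.
Proof.
rewrite !poly_evalE linear_sum; apply: eq_bigr => m _.
rewrite linearZ; congr (_ *: _); rewrite rmorph_prod.
by apply: eq_bigr => i _; rewrite rmorphXn.
Qed.

Lemma eq_poly_eval (A : comAlgType K) (x y : 'I_n -> A) :
  x =1 y -> poly_eval x =1 poly_eval y.
Proof. by move=> xy P; congr poly_eval; apply/funext. Qed.

Lemma poly_eval_id P : poly_eval (fun i => 'X_i) P = P.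
Proof.
rewrite poly_evalE [RHS]mpolyE; apply: eq_bigr => m _.
by rewrite -mpolyXE_id.
Qed.

Lemma comp_mpoly_eval k P (t : n.-tuple {mpoly K[k]}) :
  P \mPo t = poly_eval (tnth t) P.
Proof.
rewrite poly_evalE /comp_mpoly /mmap; apply: eq_bigr => m _.
by rewrite mul_mpolyC.
Qed.

Lemma der0 (A : comAlgType K) (D : derivation A) : D 0 = 0.
Proof.
by have := der_linear D (-1) 0 0; rewrite scaler0 addr0 scaleN1r addNr.
Qed.

Lemma derD (A : comAlgType K) (D : derivation A) f h : D (f + h) = D f + D h.
Proof. by have := der_linear D 1 f h; rewrite !scale1r. Qed.

Lemma derZ (A : comAlgType K) (D : derivation A) c f : D (c *: f) = c *: D f.
Proof. by have := der_linear D c f 0; rewrite !addr0 der0 addr0. Qed.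

Lemma der1 (A : comAlgType K) (D : derivation A) : D 1 = 0.
Proof.
have := der_leibniz D 1 1; rewrite !mul1r => D11.
by apply: (addIr (D 1)); rewrite add0r -D11.
Qed.

Lemma der_alg (A : comAlgType K) (D : derivation A) c : D c%:A = 0.
Proof. by rewrite derZ der1 scaler0. Qed.

Lemma mderivXU (i j : 'I_n) : ('X_i : {mpoly K[n]})^`M(j) = (i == j)%:R.
Proof.
rewrite mderivX mnm1E; case: eqVneq => [->|_]; last by rewrite scale0r.
suff -> : (U_(j) - U_(j) = 0 :> 'X_{1..n})%MM by rewrite mpolyX0 scale1r.
by apply/mnmP => l; rewrite mnmBE subnn mnm0E.
Qed.

Lemma der_poly_eval (A : comAlgType K) (D : derivation A) (x : 'I_n -> A) P :
  D (poly_eval x P) = \sum_i poly_eval x P^`M(i) * D (x i).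
Proof.
pose Q P := D (poly_eval x P) = \sum_i poly_eval x P^`M(i) * D (x i).
have QD P1 P2 : Q P1 -> Q P2 -> Q (P1 + P2).
  rewrite /Q raddfD derD => -> ->; rewrite -big_split /=.
  by apply: eq_bigr => i _; rewrite mderivD raddfD mulrDl.
have QZ c P1 : Q P1 -> Q (c *: P1).
  rewrite /Q linearZ derZ => ->; rewrite scaler_sumr.
  by apply: eq_bigr => i _; rewrite mderivZ linearZ scalerAl.
have QM P1 P2 : Q P1 -> Q P2 -> Q (P1 * P2).
  rewrite /Q rmorphM der_leibniz => -> ->.
  rewrite !mulr_sumr -big_split /=; apply: eq_bigr => i _.
  rewrite mderiv_leib rmorphD !rmorphM mulrDl /=.
  by rewrite !mulrA.
have Q1 : Q 1.
  rewrite /Q rmorph1 der1 big1 // => i _.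
  by rewrite -mpolyC1 mderivC raddf0 mul0r.
have QX i : Q 'X_i.
  rewrite /Q poly_evalX (bigD1 i) //= mderivXU eqxx rmorph1 mul1r.
  rewrite big1 ?addr0 // => j nji; rewrite mderivXU eq_sym (negPf nji).
  by rewrite raddf0 mul0r.
rewrite -/(Q P); elim/mpolyind: P => [|c m p _ _ IHp].
  by rewrite -(scale0r 1); apply: QZ.
apply: QD IHp; apply: QZ; rewrite mpolyXE_id.
elim/big_ind: _ => //= i _.
by elim: (m i) => [|k IHk] //; rewrite exprS; apply: QM.
Qed.

Lemma mderiv_poly_eval k (x : 'I_n -> {mpoly K[k]}) P j :
  (poly_eval x P)^`M(j) = \sum_i poly_eval x P^`M(i) * (x i)^`M(j).
Proof.
exact: (der_poly_eval (mder j)).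
Qed.

End PolyEval.

(** * Weighted parts of polynomials *)

Section WeightedDegree.
Context (n : nat) (d : 'I_n -> nat).
Implicit Types (m : 'X_{1..n}).

Lemma wdegD m m' : wdeg d (m + m')%MM = (wdeg d m + wdeg d m')%N.
Proof.
by rewrite /wdeg -big_split; apply: eq_bigr => i _; rewrite mnmDE mulnDr.
Qed.

Lemma wdeg0 : wdeg d 0%MM = 0%N.
Proof. by rewrite /wdeg big1 // => i _; rewrite mnm0E muln0. Qed.

Lemma wdegU i : wdeg d U_(i)%MM = d i.
Proof.
rewrite /wdeg (bigD1 i) //= mnm1E eqxx muln1 big1 ?addn0 // => j nji.
by rewrite mnm1E eq_sym (negPf nji) muln0.
Qed.

Lemma mnm_split i m : m i != 0%N -> m = (U_(i) + (m - U_(i)))%MM.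
Proof. by rewrite -lep1mP => /submK {1}<-; rewrite addmC. Qed.

Lemma wdeg_ge i m : m i != 0%N -> (d i <= wdeg d m)%N.
Proof. by move/mnm_split ->; rewrite wdegD wdegU leq_addr. Qed.

Lemma mnm_neq0 m : m != 0%MM -> exists i, m i != 0%N.
Proof.
move=> nm; apply/existsP; apply: contraNT nm;
  rewrite negb_exists => /forallP m0.
by apply/eqP/mnmP => i; rewrite mnm0E; apply/eqP; move: (m0 i); rewrite negbK.
Qed.

Lemma wdeg_eq0 m : (forall i, 0 < d i)%N -> wdeg d m = 0%N -> m = 0%MM.
Proof.
move=> d0 w0; apply/eqP; apply: contraT => /mnm_neq0 [i /wdeg_ge].
by rewrite w0 leqNgt d0.
Qed.

Lemma mdeg_le_wdeg m : (forall i, 0 < d i)%N -> (mdeg m <= wdeg d m)%N.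
Proof.
by move=> d0; rewrite mdegE; apply: leq_sum => i _; rewrite leq_pmull.
Qed.

Context (K : fieldType).
Implicit Types (P Q : {mpoly K[n]}).

(* A shift s stands for a division by a monomial of weight s: it is used for
   derivatives, so that no truncated subtraction of weights occurs. *)
Definition wpart (s k : nat) P : {mpoly K[n]} :=
  \sum_(m <- msupp P | (wdeg d m + s == k)%N) P@_m *: 'X_[m].

Definition wge (s k : nat) P : Prop :=
  forall m, P@_m != 0 -> (k <= wdeg d m + s)%N.

Lemma mcoeff_wpart s k P m :
  (wpart s k P)@_m = if (wdeg d m + s == k)%N then P@_m else 0.
Proof.
rewrite /wpart big_mkcond /= raddf_sum /= [in RHS](mpolyE P) raddf_sum /=.
case: ifPn => [wm|/negPf wm]; last first.
  rewrite big1 // => m' _; case: ifP => [wm'|_]; last by rewrite mcoeff0.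
  rewrite mcoeffZ mcoeffX; case: eqVneq => [mm|_]; last by rewrite mulr0.
  by rewrite -mm wm' in wm.
apply: eq_bigr => m' _; case: ifPn => // wm'.
rewrite mcoeff0 mcoeffZ mcoeffX; case: eqVneq => [mm|_]; last by rewrite mulr0.
by rewrite mm wm in wm'.
Qed.

Lemma wpart_is_linear s k : linear (wpart s k).
Proof.
move=> c P Q; apply/mpolyP => m.
rewrite mcoeffD mcoeffZ !mcoeff_wpart mcoeffD mcoeffZ.
by case: ifP => // _; rewrite mulr0 addr0.
Qed.
HB.instance Definition _ s k :=
  GRing.isLinear.Build K {mpoly K[n]} {mpoly K[n]} _ (wpart s k)
    (wpart_is_linear s k).

Lemma wpart_eq0 s k P :
  (forall m, (wdeg d m + s)%N = k -> P@_m = 0) -> wpart s k P = 0.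
Proof.
move=> P0; apply/mpolyP => m; rewrite mcoeff_wpart mcoeff0.
by case: eqP => // /P0.
Qed.

Lemma wpart_id s k P :
  (forall m, P@_m != 0 -> (wdeg d m + s)%N = k) -> wpart s k P = P.
Proof.
move=> hP; apply/mpolyP => m; rewrite mcoeff_wpart; case: eqP => // wm.
by apply/esym/eqP; apply: contraT => /hP.
Qed.

Lemma wpart_lt s k l P : wge s l P -> (k < l)%N -> wpart s k P = 0.
Proof.
move=> wP kl; apply: wpart_eq0 => m wm; apply/eqP; apply: contraT => /wP.
by rewrite wm leqNgt kl.
Qed.

Lemma wpart_mderiv s k i P : wpart (s + d i) k P^`M(i) = (wpart s k P)^`M(i).
Proof.
apply/mpolyP => m; rewrite mcoeff_wpart !mcoeff_deriv mcoeff_wpart.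
by rewrite wdegD wdegU addnA addnAC; case: ifP => // _; rewrite mul0rn.
Qed.

Lemma wge_mderiv s k i P : wge s k P -> wge (s + d i) k P^`M(i).
Proof.
move=> wP m; rewrite mcoeff_deriv => nz.
have /wP : P@_(m + U_(i)) != 0 by apply: contraNneq nz => ->; rewrite mul0rn.
by rewrite wdegD wdegU -addnA (addnC s).
Qed.

Lemma wgeM s t k l P Q :
  wge s k P -> wge t l Q -> wge (s + t) (k + l) (P * Q).
Proof.
move=> wP wQ m; rewrite -mcoeff_msupp => /msuppM_le /allpairsP[[m1 m2] /=].
rewrite !mcoeff_msupp => -[/wP w1 /wQ w2 ->].
by rewrite wdegD addnACA leq_add.
Qed.

Lemma wge_wpart s k P : wge s k P -> wge s k.+1 (P - wpart s k P).
Proof.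
move=> wP m; rewrite mcoeffB mcoeff_wpart; case: ifPn => [_|nk].
  by rewrite subrr eqxx.
by rewrite subr0 ltn_neqAle => /wP ->; rewrite andbT eq_sym.
Qed.

Lemma wge_part s k P : wge s k (wpart s k P).
Proof. by move=> m; rewrite mcoeff_wpart; case: ifPn => [/eqP->|];
  rewrite ?eqxx. Qed.

(** Lowest parts multiply: replacing a factor by its remainder after the lowest part pushes the
    whole product at least one weight up. *)
Lemma wpartM s t k l P Q : wge s k P -> wge t l Q ->
  wpart (s + t) (k + l) (P * Q) = wpart s k P * wpart t l Q.
Proof.
move=> wP wQ; rewrite -{1}(subrK (wpart s k P) P) mulrDl linearD /=.
rewrite (wpart_lt (wgeM (wge_wpart wP) wQ)) // add0r.
rewrite -{1}(subrK (wpart t l Q) Q) mulrDr linearD /=.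
rewrite (wpart_lt (wgeM (@wge_part s k P) (wge_wpart wQ))) ?addnS // add0r.
apply: wpart_id => m; rewrite -mcoeff_msupp => /msuppM_le /allpairsP[[m1 m2]
  /=].
rewrite !mcoeff_msupp !mcoeff_wpart => -[h1 h2 ->]; move: h1 h2.
do 2![case: ifPn => [/eqP<-|]; rewrite ?eqxx // => _].
by rewrite wdegD addnACA.
Qed.

Lemma wpart_const s k c : (s != k)%N -> wpart s k c%:MP = 0.
Proof.
move=> sk; apply: wpart_eq0 => m wm; rewrite mcoeffC.
case: eqP => [m0|_]; last by rewrite mulr0.
by rewrite -wm m0 wdeg0 add0n eqxx in sk.
Qed.

Lemma wge_const k c : wge k k c%:MP.
Proof. by move=> m _; rewrite leq_addl. Qed.

Lemma wpart_constE k c : wpart k k c%:MP = c%:MP.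
Proof.
apply: wpart_id => m; rewrite mcoeffC.
by case: (m =P 0%MM) => [->|]; rewrite ?mulr0 ?eqxx // wdeg0.
Qed.

Lemma wpart_exp k P e : wge 0 k P ->
  wge 0 (k * e) (P ^+ e) /\ wpart 0 (k * e) (P ^+ e) = wpart 0 k P ^+ e.
Proof.
move=> wP; elim: e => [|e [wE pE]].
  by rewrite muln0 !expr0 -mpolyC1; split;
    [apply: wge_const|rewrite wpart_constE].
rewrite mulnS !exprS; split; first exact: (wgeM wP wE).
by have := wpartM wP wE; rewrite addn0 pE.
Qed.

(** The bound is asked only for the [i] occurring in [m], because the expansion of the last
    invariant has a constant term and violates it. *)
Lemma wpart_prod (F : 'I_n -> {mpoly K[n]}) m :
  (forall i, m i != 0%N -> wge 0 (d i) (F i)) ->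
  wge 0 (wdeg d m) (\prod_i F i ^+ m i) /\
  wpart 0 (wdeg d m) (\prod_i F i ^+ m i) = \prod_i wpart 0 (d i) (F i) ^+ m i.
Proof.
move=> wF; rewrite /wdeg.
elim/big_rec3: _ => [|i P k Q _ [wQ pQ]].
  by rewrite -mpolyC1; split; [apply: wge_const|rewrite wpart_constE].
have [wE pE] : wge 0 (d i * m i) (F i ^+ m i) /\
    wpart 0 (d i * m i) (F i ^+ m i) = wpart 0 (d i) (F i) ^+ m i.
  have [m0|/wF] := eqVneq (m i) 0%N; last exact: wpart_exp.
  rewrite m0 muln0 !expr0 -mpolyC1.
  by split; [apply: wge_const|rewrite wpart_constE].
split; first exact: (wgeM wE wQ).
by have := wpartM wE wQ; rewrite addn0 pE pQ.
Qed.

End WeightedDegree.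

Lemma trmx_congr (A : comPzRingType) n (L H : 'M[A]_n) :
  H^T = H -> (L^T *m H *m L)^T = L^T *m H *m L.
Proof. by move=> symH; rewrite !trmx_mul trmxK symH mulmxA. Qed.

(** The adjugate replaces the inverse: over a polynomial ring a nonzero determinant need not be a
    unit. *)
Lemma congr_mx_eq0 (A : idomainType) n (L H : 'M[A]_n) :
  \det L != 0 -> L^T *m H *m L = 0 -> H = 0.
Proof.
move=> detL LHL.
have : \adj L^T *m (L^T *m H *m L) *m \adj L = 0 by rewrite LHL mulmx0 mul0mx.
rewrite !mulmxA mul_adj_mx det_tr mul_scalar_mx -!mulmxA mul_mx_adj.
rewrite mul_mx_scalar => /matrixP H0; apply/matrixP => i j.
have /eqP := H0 i j; rewrite !mxE !mulf_eq0 (negPf detL) /=.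
by move/eqP.
Qed.

(** * Polynomial maps with constant Gram matrix *)

Section Hessian.
Context (K : numFieldType) (n : nat).
Implicit Types (P X : {mpoly K[n]}) (m : 'X_{1..n}).

Lemma mcoeff_mderiv_neq0 i m P :
  m i != 0%N -> P@_m != 0 -> P^`M(i)@_(m - U_(i)) != 0.
Proof.
move=> mi nz; rewrite mcoeff_deriv addmC -mnm_split //.
by rewrite mulrn_eq0 (negPf nz).
Qed.

Lemma mderiv2_eq0_mdeg P : (forall i j, P^`M(i)^`M(j) = 0) ->
  forall m, P@_m != 0 -> (mdeg m <= 1)%N.
Proof.
move=> P0 m nz; have [->|/mnm_neq0[i mi]] := eqVneq m 0%MM;
  first by rewrite mdeg0.
have [m0|/mnm_neq0[j mj]] := eqVneq (m - U_(i))%MM 0%MM.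
  by rewrite (mnm_split mi) m0 addm0 mdeg1.
have := mcoeff_mderiv_neq0 mj (mcoeff_mderiv_neq0 mi nz).
by rewrite P0 mcoeff0 eqxx.
Qed.

Lemma mdeg_le1_linear P : P@_0 = 0 -> (forall m, P@_m != 0 -> (mdeg m <= 1)%N)
  ->
  P = \sum_i P@_U_(i) *: 'X_i.
Proof.
move=> P0 P1; apply/mpolyP => m; rewrite raddf_sum /=.
have [->|nm] := eqVneq m 0%MM.
  by rewrite P0 big1 // => i _; rewrite mcoeffZ mcoeffX mnm1_eq0 mulr0.
have [/mdeg1P[j /eqP ->]|nm1] := boolP (mdeg m == 1%N).
  rewrite (bigD1 j) //= mcoeffZ mcoeffX eqxx mulr1 big1 ?addr0 // => i nij.
  by rewrite mcoeffZ mcoeffX eq_mnm1 (negPf nij) mulr0.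
rewrite big1 => [|i _]; last first.
  rewrite mcoeffZ mcoeffX; case: eqP => [mi|_]; last by rewrite mulr0.
  by rewrite -mi mdeg1 in nm1.
apply/eqP; apply: contraT => /P1; case: (mdeg m) (mdeg_eq0 m) nm1 => [|[|]] //.
by rewrite eqxx (negPf nm).
Qed.

(* With L = M (dX)^T, the tensor L_b^T (Hess X_a) L_e is symmetric in b and e
   and, as the Gram matrix is constant, antisymmetric in a and b. *)
Lemma constant_gram_hessian (X : 'I_n -> {mpoly K[n]}) (M : 'M[K]_n)
    (h : 'I_n -> 'I_n -> K) :
  M^T = M -> M \in unitmx -> \det (\matrix_(a, i) (X a)^`M(i)) != 0 ->
  (forall a b,
     \sum_i \sum_j M i j *: ((X a)^`M(i) * (X b)^`M(j)) = (h a b)%:MP) ->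
  forall a i j, (X a)^`M(i)^`M(j) = 0.
Proof.
move=> symM uM detJ hJ.
pose J := \matrix_(a, i) (X a)^`M(i); pose N := map_mx (@mpolyC n K) M.
pose L := N *m J^T.
pose H a := \matrix_(i, j) (X a)^`M(i)^`M(j).
pose T a b e := (L^T *m H a *m L) b e.
have TE a b e : T a b e =
    \sum_j (\sum_i \sum_l M i l *: ((X a)^`M(i)^`M(j) * (X b)^`M(l))) * L j e.
  rewrite /T mxE; apply: eq_bigr => j _; congr (_ * _).
  rewrite mxE; apply: eq_bigr => i _; rewrite !mxE mulr_suml.
  by apply: eq_bigr => l _; rewrite !mxE mul_mpolyC mulrC -scalerAr.
have symT a b e : T a b e = T a e b.
  have symH : (H a)^T = H a.
    by apply/matrixP => i j; rewrite /H !mxE; apply: mderiv_comm.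
  by have /matrixP/(_ e b) := trmx_congr L symH; rewrite mxE.
have antiT a b e : T a b e + T b a e = 0.
  rewrite !TE -big_split big1 //= => j _; rewrite -mulrDl.
  rewrite [X in _ + X]exchange_big -big_split /=.
  rewrite [X in X * _ = _](_ : _ =
    (\sum_i \sum_l M i l *: ((X a)^`M(i) * (X b)^`M(l)))^`M(j)).
    by rewrite hJ mderivC mul0r.
  rewrite [RHS]raddf_sum; apply: eq_bigr => i _.
  rewrite [RHS]raddf_sum -big_split /=; apply: eq_bigr => l _.
  rewrite mderivZ mderivM scalerDr; congr (_ + _).
  by rewrite mulrC -{1}symM mxE.
(* Alternating the two symmetries three times each returns to the indices a, b, e after three sign
   changes, so T = - T. *)
have T0 a b e : T a b e = 0.
  have T2 : T a b e = - T a b e.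
    have anti x y z : T x y z = - T y x z by apply/eqP; rewrite -addr_eq0 antiT.
    by rewrite {1}anti symT anti opprK symT anti symT.
  have : T a b e *+ 2 = 0 by rewrite mulr2n {1}T2 addNr.
  rewrite -scaler_nat => /eqP; rewrite scaler_eq0 pnatr_eq0 /=.
  by move/eqP.
move=> a i j.
have LHL : L^T *m H a *m L = 0 by apply/matrixP => b e; rewrite [RHS]mxE;
  apply: T0.
have detL : \det L != 0.
  rewrite /L det_mulmx det_tr; apply: mulf_neq0; last exact: detJ.
  by rewrite /N det_map_mx mpolyC_eq0 -unitfE -unitmxE.
by have /matrixP/(_ i j) := congr_mx_eq0 detL LHL; rewrite !mxE.
Qed.

End Hessian.

(** * Leading parts of Taylor expansions *)

Section LeadingPart.
Context (K : numFieldType) (n : nat) (d : 'I_n.+1 -> nat).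
Local Notation top := (@ord_max n).

(* The Taylor expansions u a of basic invariants at q: apart from the value c
   of the last one at q, u a starts in weight d a, and its next weight is at
   least d a + d_n. *)
Record taylor_family (u : 'I_n.+1 -> {mpoly K[n.+1]}) (c : K) : Prop :=
  TaylorFamily {
  tf_ge2 : forall a, (1 < d a)%N;
  tf_lt : forall a, a != top -> (d a < d top)%N;
  tf_c : c != 0;
  tf_cst : forall a, (u a)@_0 = c *+ (a == top);
  tf_weight : forall a m, m != 0%MM -> (u a)@_m != 0 ->
    wdeg d m = d a \/ (d a + d top <= wdeg d m)%N;
  tf_jacobian : \matrix_(a, i) (u a)@_U_(i) \in unitmx
}.

Context (u : 'I_n.+1 -> {mpoly K[n.+1]}) (c : K) (uc : taylor_family u c).
Implicit Types (a b i j : 'I_n.+1) (m : 'X_{1..n.+1}) (P : {mpoly K[n.+1]}).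

(** When [u] is the family of expansions of x, this is psi(x^a) written in the coordinates z
    ([psi_basic]). *)
Definition lead a : {mpoly K[n.+1]} := wpart d 0 (d a) (u a).

Let d_gt0 a : (0 < d a)%N. Proof. exact: ltnW (tf_ge2 uc a). Qed.

Let d_le a : (d a <= d top)%N.
Proof. by have [->|/(tf_lt uc)/ltnW] := eqVneq a top. Qed.

Lemma wge_lead a : a != top -> wge d 0 (d a) (u a).
Proof.
move=> na m; have [->|nm] := eqVneq m 0%MM.
  by rewrite (tf_cst uc) (negPf na) eqxx.
case/(tf_weight uc nm) => [->|]; rewrite addn0 //.
by apply: leq_trans; rewrite leq_addr.
Qed.

Lemma mderiv_subC P (k : K) i : (P - k%:MP)^`M(i) = P^`M(i).
Proof. by rewrite mderivB mderivC subr0. Qed.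

Lemma wge_sub_cst a : wge d 0 (d a) (u a - ((u a)@_0)%:MP).
Proof.
move=> m; rewrite mcoeffB mcoeffC; have [->|nm] := eqVneq m 0%MM.
  by rewrite mulr1 subrr eqxx.
rewrite mulr0 subr0 addn0 => /(tf_weight uc nm)[-> //|].
by apply: leq_trans; rewrite leq_addr.
Qed.

Lemma wge_mderiv_u a i : wge d (d i) (d a) (u a)^`M(i).
Proof.
by have := wge_mderiv (i := i) (@wge_sub_cst a); rewrite mderiv_subC add0n.
Qed.

Lemma wpart_mderiv_u a i : wpart d (d i) (d a) (u a)^`M(i) = (lead a)^`M(i).
Proof. by have := @wpart_mderiv _ d K 0 (d a) i (u a); rewrite add0n. Qed.

Lemma wpart_shift s t k P : wpart d (s + t) (k + t) P = wpart d s k P.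
Proof.
by apply/mpolyP => m; rewrite !mcoeff_wpart addnA eqn_add2r.
Qed.

Lemma top_le1 m : (wdeg d m < d top + d top)%N -> (m top <= 1)%N.
Proof.
apply: contraTT; rewrite -ltnNge -leqNgt => m2.
have m1 : m top != 0%N by case: (m top) m2.
rewrite (mnm_split m1) wdegD wdegU leq_add2l; apply: wdeg_ge.
by rewrite mnmBE mnm1E eqxx -lt0n subn_gt0.
Qed.

(** Without x^n the substituted monomial has no terms below its own weight, and both sides vanish.
    Otherwise x^n occurs once; a drop of the weight by d_n can only come from replacing it by its
    constant [c]. *)
Lemma wpart_top_monomial m : (wdeg d m < d top + d top)%N ->
  wpart d (d top) (wdeg d m) (poly_eval u 'X_[m]) =
  c *: poly_eval lead ('X_[m])^`M(top).
Proof.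
move=> wm; rewrite mderivX.
have wlead m' : m' top = 0%N ->
    wge d 0 (wdeg d m') (poly_eval u 'X_[m']) /\
    wpart d 0 (wdeg d m') (poly_eval u 'X_[m']) = poly_eval lead 'X_[m'].
  move=> m0; rewrite !poly_evalXm; apply: wpart_prod => a ma.
  by apply: wge_lead; apply: contraNneq ma => ->; rewrite m0.
have [m0|m1] := eqVneq (m top) 0%N.
  rewrite m0 scale0r raddf0 scaler0; apply: wpart_eq0 => m' wm'.
  apply/eqP; apply: contraT => /(proj1 (wlead _ m0)).
  by rewrite addn0 -wm' -{2}(addn0 (wdeg d m')) leq_add2l leqNgt d_gt0.
have mt : m top = 1%N.
  by have := top_le1 wm; case: (m top) m1 => [|[|]].
rewrite mt scale1r {1 2}(mnm_split m1); set m' := (m - _)%MM.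
have m't : m' top = 0%N by rewrite mnmBE mnm1E eqxx mt.
rewrite wdegD wdegU mpolyXD rmorphM /= poly_evalX -[d top in X in wpart d
  X]addn0.
have [w1 p1] := wlead _ m't.
(* The factor [u top] contributes its part of weight 0, which is [c]; the other factors contribute
   their leading parts. *)
rewrite wpartM //; last by move=> m2 _; rewrite leq_addl.
rewrite p1 -mul_mpolyC; congr (_ * _); apply/mpolyP => m2.
rewrite mcoeff_wpart mcoeffC -{2}(add0n (d top)) eqn_add2r.
case: ifP => [/eqP/(wdeg_eq0 d_gt0) ->|].
  by rewrite (tf_cst uc) !eqxx mulr1.
by case: (m2 =P 0%MM) => [->|_]; rewrite ?wdeg0 ?mulr0.
Qed.

Lemma poly_eval_supp (A : comAlgType K) (x : 'I_n.+1 -> A) P :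
  poly_eval x P = \sum_(m <- msupp P) P@_m *: poly_eval x 'X_[m].
Proof.
by rewrite {1}(mpolyE P) linear_sum; apply: eq_bigr => m _; rewrite linearZ.
Qed.

Lemma wpart_top P D : (D < d top + d top)%N ->
  {in msupp P, forall m, wdeg d m = D} ->
  wpart d (d top) D (poly_eval u P) = c *: poly_eval lead P^`M(top).
Proof.
move=> DP wP; rewrite (poly_eval_supp _ P) linear_sum /=.
have -> : poly_eval lead P^`M(top) =
    \sum_(m <- msupp P) P@_m *: poly_eval lead ('X_[m])^`M(top).
  rewrite {1}(mpolyE P) (linear_sum (mderiv top)) (linear_sum (poly_eval lead)).
  by apply: eq_bigr => m _; rewrite /= mderivZ linearZ.
rewrite (linear_sum ( *:%R c)) big_seq [RHS]big_seq; apply: eq_bigr => m /wP wm.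
rewrite linearZ /= scalerA mulrC -scalerA; congr (_ *: _).
by rewrite -wm wpart_top_monomial ?wm.
Qed.

(** Products of x^n with other invariants must be excluded: there the constant [c] would multiply
    terms of the other expansions beyond the leading ones, which have the same total weight. *)
Lemma wpart_low P D : (0 < D)%N -> {in msupp P, forall m, wdeg d m = D} ->
  {in msupp P, forall m, m top = 0%N \/ m = U_(top)%MM} ->
  wpart d 0 D (poly_eval u P) = poly_eval lead P.
Proof.
move=> D0 wP tP; rewrite !(poly_eval_supp _ P) linear_sum /=.
rewrite big_seq [RHS]big_seq; apply: eq_bigr => m mP.
rewrite linearZ /=; congr (_ *: _); have [m0|mU] := tP _ mP.
  rewrite -(wP _ mP) !poly_evalXm.
  have [|_ ->] // := @wpart_prod n.+1 d K u m => a ma.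
  by apply: wge_lead; apply: contraNneq ma => ->; rewrite m0.
by rewrite -(wP _ mP) mU wdegU !poly_evalX.
Qed.

(* The weight -d_n part of the identity P(u) = I^*(du_a, du_b). *)
Lemma lead_gram (M : 'M[K]_n.+1) P a b :
  (forall i j, M i j != 0 -> (d i + d j = d top + 2)%N) ->
  {in msupp P, forall m, wdeg d m + 2 = d a + d b}%N ->
  poly_eval u P = \sum_i \sum_j M i j *: ((u a)^`M(i) * (u b)^`M(j)) ->
  \sum_i \sum_j M i j *: ((lead a)^`M(i) * (lead b)^`M(j)) =
  c *: poly_eval lead P^`M(top).
Proof.
move=> wM wP eP; pose D := (d a + d b - 2)%N.
have DE : (D + 2 = d a + d b)%N.
  by rewrite subnK // (leq_trans (tf_ge2 uc a)) ?leq_addr.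
have wPD : {in msupp P, forall m, wdeg d m = D}.
  by move=> m /wP; rewrite -DE => /eqP; rewrite eqn_add2r => /eqP.
have D2 : (D < d top + d top)%N.
  rewrite -(ltn_add2r 2) DE; apply: (@leq_ltn_trans (d top + d top)).
    exact: leq_add.
  by rewrite -[X in (X < _)%N]addn0 ltn_add2l.
(* Adding 2 to the shift and to the weight makes the shift d_n + 2 = d_i + d_j, the one carried by a
   product of derivatives in z^i and z^j. *)
rewrite -(wpart_top D2 wPD) -(wpart_shift _ 2) DE eP.
rewrite (linear_sum (wpart d (d top + 2) (d a + d b))); apply: eq_bigr => i _.
rewrite (linear_sum (wpart d _ _)); apply: eq_bigr => j _.
rewrite linearZ /=; have [->|/wM <-] := eqVneq (M i j) 0;
  first by rewrite !scale0r.
by rewrite wpartM ?wpart_mderiv_u //; apply: wge_mderiv_u.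
Qed.

(** A linear monomial has weight d_i <= d_n < d_a + d_n, so if it occurs in [u a] it already lies in
    the leading part. *)
Lemma mcoeff_leadU a i : (lead a)@_U_(i) = (u a)@_U_(i).
Proof.
rewrite mcoeff_wpart wdegU addn0; case: ifPn => // nai.
apply/esym/eqP; apply: contraT => /(tf_weight uc (negbT (mnm1_eq0 i))).
rewrite wdegU => -[dd|]; first by rewrite dd eqxx in nai.
by rewrite leqNgt (leq_ltn_trans (d_le i)) // -{1}(add0n (d top)) ltn_add2r.
Qed.

Lemma lead0 a : (lead a)@_0 = 0.
Proof. by rewrite mcoeff_wpart wdeg0 add0n ltn_eqF. Qed.

(** At the origin this Jacobian matrix equals that of [u], which is invertible. *)
Lemma lead_det : \det (\matrix_(a, i) (lead a)^`M(i)) != 0.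
Proof.
have := tf_jacobian uc; rewrite unitmxE unitfE; apply: contra => /eqP D0.
have <- : map_mx (@mcoeff n.+1 K 0%MM) (\matrix_(a, i) (lead a)^`M(i)) =
    \matrix_(a, i) (u a)@_U_(i).
  apply/matrixP => a i; rewrite !mxE mcoeff_deriv add0m mnm0E mulr1n.
  exact: mcoeff_leadU.
by rewrite det_map_mx D0 raddf0.
Qed.

Lemma lead_linear (M : 'M[K]_n.+1) (h : 'I_n.+1 -> 'I_n.+1 -> K) :
  M^T = M -> M \in unitmx ->
  (forall a b, \sum_i \sum_j M i j *: ((lead a)^`M(i) * (lead b)^`M(j)) =
     (h a b)%:MP) ->
  forall a, lead a = \sum_i (u a)@_U_(i) *: 'X_i.
Proof.
move=> sM uM hM a; rewrite {1}(@mdeg_le1_linear _ _ (lead a)) ?lead0 //.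
  by apply: eq_bigr => i _; rewrite mcoeff_leadU.
apply: mderiv2_eq0_mdeg => i j.
exact: (constant_gram_hessian sM uM lead_det hM).
Qed.

End LeadingPart.

(** * The metric on the next weight layer, when the leading parts are coordinates *)

Section NextPart.
Context (K : numFieldType) (n : nat) (d : 'I_n.+1 -> nat).
Local Notation top := (@ord_max n).
Context (u : 'I_n.+1 -> {mpoly K[n.+1]}) (c : K) (uc : taylor_family d u c).
Implicit Types (a b i j : 'I_n.+1) (m : 'X_{1..n.+1}) (P : {mpoly K[n.+1]}).

Lemma mderiv_const_supp P i k : P^`M(i) = k%:MP ->
  {in msupp P, forall m, m i = 0%N \/ m = U_(i)%MM}.
Proof.
move=> Pk m; rewrite mcoeff_msupp => nz.
have [|mi] := eqVneq (m i) 0%N; [by left | right].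
have := mcoeff_mderiv_neq0 mi nz; rewrite Pk mcoeffC.
have [m0 _|] := eqVneq (m - U_(i))%MM 0%MM; last by rewrite mulr0 eqxx.
by rewrite (mnm_split mi) m0 addm0.
Qed.

Hypothesis lead_var : forall a, lead d u a = 'X_a.
Context (M : 'M[K]_n.+1) (P : {mpoly K[n.+1]}) (a b : 'I_n.+1).
Hypothesis wM : forall i j, M i j != 0 -> (d i + d j = d top + 2)%N.
Hypothesis wP : {in msupp P, forall m, wdeg d m + 2 = d a + d b}%N.
Hypothesis eP :
  poly_eval u P = \sum_i \sum_j M i j *: ((u a)^`M(i) * (u b)^`M(j)).

Lemma sum_delta_l (F : 'I_n.+1 -> 'I_n.+1 -> {mpoly K[n.+1]}) :
  \sum_i \sum_j M i j *: ((a == i)%:R * F i j) = \sum_j M a j *: F a j.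
Proof.
rewrite (bigD1 a) //= [X in _ + X]big1 ?addr0 => [|i nia]; last first.
  by rewrite big1 // => j _; rewrite eq_sym (negPf nia) mul0r scaler0.
by apply: eq_bigr => j _; rewrite eqxx mul1r.
Qed.

Lemma sum_delta_r (F : 'I_n.+1 -> 'I_n.+1 -> {mpoly K[n.+1]}) :
  \sum_i \sum_j M i j *: (F i j * (b == j)%:R) = \sum_i M i b *: F i b.
Proof.
apply: eq_bigr => i _; rewrite (bigD1 b) //= [X in _ + X]big1 ?addr0.
  by rewrite eqxx mulr1.
by move=> j njb; rewrite eq_sym (negPf njb) mulr0 scaler0.
Qed.

(** As the leading parts are the variables themselves, the substitution in [lead_gram] is the
    identity and its left side is the entry M a b. *)
Lemma mderiv_top_gram : P^`M(top) = (c^-1 * M a b)%:MP.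
Proof.
have := lead_gram uc wM wP eP.
rewrite (eq_poly_eval lead_var) poly_eval_id.
under eq_bigr => i _ do under eq_bigr => j _ do rewrite !lead_var !mderivXU.
rewrite sum_delta_l (bigD1 b) //= big1 ?addr0 => [|j njb]; last first.
  by rewrite eq_sym (negPf njb) scaler0.
rewrite eqxx => /(congr1 ( *:%R c^-1)); rewrite !scalerA mulVf ?(tf_c uc) //.
by rewrite scale1r => <-; rewrite alg_mpolyC.
Qed.

(** What remains of a first derivative after its leading constant; it starts d_n higher than the
    derivative itself. *)
Let s e i := (u e)^`M(i) - (e == i)%:R.

Let wge_s e i : wge d (d i) (d e + d top) (s e i).
Proof.
have <- : (u e - ((u e)@_0)%:MP - lead d u e)^`M(i) = s e i.
  by rewrite mderivB mderiv_subC lead_var mderivXU.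
have -> : d i = (0 + d i)%N by []; apply: wge_mderiv => m.
rewrite !mcoeffB mcoeff_wpart mcoeffC addn0; have [->|nm] := eqVneq m 0%MM.
  by rewrite mulr1 subrr wdeg0 ltn_eqF ?subr0 ?eqxx // ltnW // (tf_ge2 uc).
rewrite mulr0 subr0; case: ifPn => [_|nw]; first by rewrite subrr eqxx.
by rewrite subr0 => nz; case: (tf_weight uc nm nz) => // /eqP;
  rewrite (negPf nw).
Qed.

(** Each derivative is a Kronecker delta plus a remainder [s]. In the weight considered, the
    products of two deltas are too low and the products of two remainders too high, so only the
    terms linear in the derivatives survive. *)
Lemma lead_gram_next :
  P = wpart d 2 (d a + d b)
        (\sum_j M a j *: (u b)^`M(j) + \sum_i M i b *: (u a)^`M(i)).
Proof.
pose D := (d a + d b - 2)%N.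
have dab : (3 < d a + d b)%N by apply: (leq_add (tf_ge2 uc a) (tf_ge2 uc b)).
have DE : (D + 2 = d a + d b)%N by rewrite subnK // ltnW // ltnW.
have wPD : {in msupp P, forall m, wdeg d m = D}.
  by move=> m /wP; rewrite -DE => /eqP; rewrite eqn_add2r => /eqP.
have D0 : (0 < D)%N by rewrite subn_gt0 ltnW.
have := wpart_low uc D0 wPD (mderiv_const_supp mderiv_top_gram).
rewrite (eq_poly_eval lead_var) poly_eval_id => {1}<-.
rewrite -(wpart_shift d 0 2) DE add0n eP.
pose V := \sum_j M a j *: (u b)^`M(j) + \sum_i M i b *: (u a)^`M(i).
have -> : \sum_i \sum_j M i j *: ((u a)^`M(i) * (u b)^`M(j)) =
    V - (M a b)%:MP + \sum_i \sum_j M i j *: (s a i * s b j).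
  have -> : (M a b)%:MP = \sum_i \sum_j M i j *: ((a == i)%:R * (b == j)%:R)
      :> {mpoly K[n.+1]}.
    apply/esym; apply: (etrans (sum_delta_r (fun i j => (a == i)%:R))).
    rewrite (bigD1 a) //= eqxx.
    rewrite big1 ?addr0 ?alg_mpolyC // => i nia.
    by rewrite eq_sym (negPf nia) scaler0.
  rewrite /V; have /= <- := sum_delta_l (fun i j => (u b)^`M(j)).
  have /= <- := sum_delta_r (fun i j => (u a)^`M(i)).
  rewrite -big_split -sumrB -big_split; apply: eq_bigr => i _ /=.
  rewrite -big_split -sumrB -big_split; apply: eq_bigr => j _ /=.
  rewrite -scalerDr -scalerBr -scalerDr; congr (_ *: _).
  by rewrite /s; ring.
(* The constant M a b has weight 0, whereas the part taken has weight d_a + d_b - 2 > 0. *)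
rewrite linearD linearB /= wpart_const ?subr0; last first.
  by rewrite neq_ltn (ltn_trans _ dab).
rewrite -/V -[RHS]addr0; congr (_ + _).
rewrite (linear_sum (wpart d _ _)) big1 // => i _.
rewrite (linear_sum (wpart d _ _)) big1 // => j _.
rewrite linearZ /=; have [->|/wM dij] := eqVneq (M i j) 0;
  first by rewrite scale0r.
(* With shift d_n + 2 this product starts at d_a + d_b + 2 d_n, above the d_a + d_b + d_n of the
   part taken. *)
have w2 := wgeM (@wge_s a i) (@wge_s b j).
rewrite (_ : wpart _ _ _ _ = 0) ?scaler0 //.
rewrite -(wpart_shift d 2 (d top)); move: w2; rewrite dij addnACA addnC.
move/wpart_lt; rewrite (addnC 2%N) => -> //.
by rewrite ltn_add2l -[X in (X < _)%N]addn0 ltn_add2l ltnW // (tf_ge2 uc).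
Qed.

End NextPart.

(** * Taylor expansions *)

Section Chart.
Context (K : numFieldType) (n : nat) (Z : 'M[K]_n) (q : 'rV[K]_n).
Hypothesis uZ : Z \in unitmx.
Implicit Types (F H : {mpoly K[n]}) (m : 'X_{1..n}) (a i j : 'I_n).

(* The function v |-> F (q + v) in the coordinates z^a (v). *)
Definition chart i : {mpoly K[n]} := (q 0 i)%:MP + \sum_a invmx Z i a *: 'X_a.
Definition taylor F : {mpoly K[n]} := poly_eval chart F.

Lemma taylor_mderiv a F : (taylor F)^`M(a) = taylor (dz Z a F).
Proof.
rewrite mderiv_poly_eval /taylor /dz (linear_sum (poly_eval chart)).
apply: eq_bigr => i _; rewrite linearZ /= -mul_mpolyC mulrC; congr (_ * _).
rewrite /chart mderivD mderivC add0r (linear_sum (mderiv a)) /=.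
rewrite (bigD1 a) //= big1 ?addr0 => [|b nba].
  by rewrite mderivZ mderivXU eqxx -mul_mpolyC mulr1.
by rewrite mderivZ mderivXU (negPf nba) scaler0.
Qed.

Lemma taylor_cst F : (taylor F)@_0 = ev q F.
Proof.
rewrite /taylor poly_evalE raddf_sum /ev mevalE; apply: eq_bigr => m _.
rewrite /= mcoeffZ; congr (_ * _).
rewrite (rmorph_prod (mcoeff 0%MM)); apply: eq_bigr => i _.
rewrite rmorphXn /=; congr (_ ^+ _); rewrite /chart mcoeffD mcoeffC eqxx mulr1.
rewrite raddf_sum big1 ?addr0 //= => a _.
by rewrite mcoeffZ mcoeffX mnm1_eq0 mulr0.
Qed.

Lemma taylor_mderivm m F : (taylor F)^`M[m] = taylor (dzm Z m F).
Proof.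
rewrite /mderivm /dzm; elim: (enum 'I_n) => //= i s ->.
by elim: (m i) => //= k ->; rewrite taylor_mderiv.
Qed.

Lemma mcoeff_taylor m F : (taylor F)@_m = (mnm_fact m)%:R^-1 * ev q (dzm Z m F).
Proof.
rewrite -taylor_cst -taylor_mderivm mcoeff_mderivm addm0 -[X in _ * X]mulr_natl.
have -> : (\prod_i (m i) ^_ (m i))%N = mnm_fact m.
  by apply: eq_bigr => i _; rewrite ffactnn.
rewrite mulKf // pnatr_eq0 -lt0n /mnm_fact; apply: prodn_gt0 => i.
exact: fact_gt0.
Qed.

Lemma sum_invmx_zform i : \sum_a invmx Z i a *: zform Z a = 'X_i.
Proof.
transitivity (\sum_j (invmx Z *m Z) i j *: ('X_j : {mpoly K[n]})).
  under [RHS]eq_bigr => j _ do rewrite mxE scaler_suml.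
  rewrite [RHS]exchange_big; apply: eq_bigr => a _ /=;
    rewrite /zform scaler_sumr.
  by apply: eq_bigr => j _; rewrite scalerA.
rewrite mulVmx // (bigD1 i) //= mxE eqxx scale1r big1 ?addr0 // => j nji.
by rewrite mxE eq_sym (negPf nji) scale0r.
Qed.

(** The inverse substitution sends the variable of index a to z^a - z^a(q). *)
Lemma taylor_inj : injective taylor.
Proof.
pose y a : {mpoly K[n]} := zform Z a - (ev q (zform Z a))%:MP.
apply: (can_inj (g := poly_eval y)) => F.
rewrite (poly_eval_morph (poly_eval y)) -[RHS]poly_eval_id.
apply: eq_poly_eval => i /=; rewrite /chart linearD /= poly_evalC linear_sum /=.
under eq_bigr => a _ do rewrite linearZ /= poly_evalX /y scalerBr.
rewrite sumrB sum_invmx_zform.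
suff -> : \sum_a invmx Z i a *: (ev q (zform Z a))%:MP = (q 0 i)%:MP_[n].
  by rewrite alg_mpolyC addrC subrK.
have <- : \sum_a invmx Z i a * ev q (zform Z a) = q 0 i.
  have := congr1 (ev q) (sum_invmx_zform i); rewrite /ev mevalXU => <-.
  by rewrite (raddf_sum (meval _)); apply: eq_bigr => a _; rewrite /= mevalZ.
apply/esym; rewrite raddf_sum; apply: eq_bigr => a _ /=.
by rewrite mpolyCM mul_mpolyC.
Qed.

(** [dzm] iterates the operators [dz] in a fixed order, so their commutation is needed; [taylor]
    reduces it to that of the ordinary partial derivatives. *)
Lemma dzm_dz m j F : dzm Z m (dz Z j F) = dzm Z (m + U_(j)) F.
Proof.
apply: taylor_inj; rewrite -!taylor_mderivm -taylor_mderiv addmC mderivmDm.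
by rewrite mderivmU1m.
Qed.

Lemma poly_eval_zform_inj : injective (poly_eval (zform Z)).
Proof.
pose y i : {mpoly K[n]} := \sum_a invmx Z i a *: 'X_a.
apply: (can_inj (g := poly_eval y)) => F.
rewrite (poly_eval_morph (poly_eval y)) -[RHS]poly_eval_id.
apply: eq_poly_eval => a /=; rewrite /zform linear_sum /=.
under eq_bigr => i _ do rewrite linearZ /= poly_evalX /y scaler_sumr.
rewrite exchange_big /=.
transitivity (\sum_b (Z *m invmx Z) a b *: ('X_b : {mpoly K[n]})).
  apply: eq_bigr => b _; rewrite mxE scaler_suml.
  by apply: eq_bigr => i _; rewrite scalerA.
rewrite mulmxV // (bigD1 a) //= mxE eqxx scale1r big1 ?addr0 // => j nji.
by rewrite mxE eq_sym (negPf nji) scale0r.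
Qed.

Lemma mderiv_dz i F : F^`M(i) = \sum_a Z a i *: dz Z a F.
Proof.
transitivity (\sum_j (invmx Z *m Z) j i *: F^`M(j)).
  rewrite mulVmx // (bigD1 i) //= mxE eqxx scale1r big1 ?addr0 // => j nji.
  by rewrite mxE (negPf nji) scale0r.
under eq_bigr => j _ do rewrite mxE scaler_suml.
rewrite exchange_big; apply: eq_bigr => a _; rewrite /dz scaler_sumr.
by apply: eq_bigr => j _; rewrite scalerA mulrC.
Qed.

Context (B : 'M[K]_n) (sB : B^T = B) (uB : B \in unitmx).

Definition dual_gram : 'M[K]_n := \matrix_(a, b) dual_form B (row a Z) (row b
  Z).

Lemma dual_gramE : dual_gram = Z *m invmx B *m Z^T.
Proof.
apply/matrixP => a b; rewrite mxE /dual_form /bilin mulmxKV // !trmx_mul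
  trmx_inv sB.
by rewrite !mulmxA -!row_mul !mxE; apply: eq_bigr => i _; rewrite !mxE.
Qed.

Lemma dual_gram_sym : dual_gram^T = dual_gram.
Proof. by rewrite dual_gramE !trmx_mul trmxK trmx_inv sB mulmxA. Qed.

Lemma dual_gram_unit : dual_gram \in unitmx.
Proof. by rewrite dual_gramE !unitmx_mul unitmx_tr unitmx_inv uZ uB. Qed.

Lemma sum_dual_gram (f h : 'I_n -> {mpoly K[n]}) :
  \sum_i \sum_j invmx B i j *:
    ((\sum_a Z a i *: f a) * (\sum_b Z b j *: h b)) =
  \sum_a \sum_b dual_gram a b *: (f a * h b).
Proof.
pose t i j a b := (invmx B i j * Z a i * Z b j) *: (f a * h b).
transitivity (\sum_i \sum_j \sum_a \sum_b t i j a b).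
  apply: eq_bigr => i _; apply: eq_bigr => j _.
  rewrite mulr_suml scaler_sumr; apply: eq_bigr => a _.
  rewrite mulr_sumr scaler_sumr; apply: eq_bigr => b _.
  by rewrite -scalerAl -scalerAr !scalerA.
transitivity (\sum_a \sum_b \sum_j \sum_i t i j a b); last first.
  apply: eq_bigr => a _; apply: eq_bigr => b _.
  rewrite dual_gramE mxE scaler_suml; apply: eq_bigr => j _.
  rewrite !mxE mulr_suml scaler_suml; apply: eq_bigr => i _.
  by rewrite /t (mulrC (Z a i)).
under eq_bigr => i _ do under eq_bigr => j _ do rewrite exchange_big.
under eq_bigr => i _ do rewrite exchange_big.
under eq_bigr => i _ do under eq_bigr => b _ do rewrite exchange_big.
rewrite exchange_big /=.
under eq_bigr => b _ do rewrite exchange_big.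
rewrite exchange_big /=; apply: eq_bigr => a _; apply: eq_bigr => b _.
by rewrite exchange_big.
Qed.

Lemma IstarE_dz f h : Istar B f h =
  \sum_a \sum_b dual_gram a b *: (dz Z a f * dz Z b h).
Proof.
rewrite -sum_dual_gram; apply: eq_bigr => i _; apply: eq_bigr => j _.
by rewrite dual_form_delta // -!mderiv_dz.
Qed.

Lemma taylor_Istar f h : taylor (Istar B f h) =
  \sum_a \sum_b dual_gram a b *: ((taylor f)^`M(a) * (taylor h)^`M(b)).
Proof.
rewrite IstarE_dz /taylor linear_sum; apply: eq_bigr => a _.
rewrite linear_sum; apply: eq_bigr => b _; rewrite linearZ rmorphM /=.
by rewrite -!/(taylor _) !taylor_mderiv.
Qed.

Lemma Istar_zform f h :
  Istar B (poly_eval (zform Z) f) (poly_eval (zform Z) h) =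
  poly_eval (zform Z) (\sum_a \sum_b dual_gram a b *: (f^`M(a) * h^`M(b))).
Proof.
have dzf k i : (poly_eval (zform Z) k)^`M(i) =
    \sum_a Z a i *: poly_eval (zform Z) k^`M(a).
  rewrite mderiv_poly_eval; apply: eq_bigr => a _.
  rewrite -mul_mpolyC mulrC; congr (_ * _).
  rewrite /zform raddf_sum (bigD1 i) //= mderivZ mderivXU eqxx big1 ?addr0.
    by rewrite -mul_mpolyC mulr1.
  by move=> j nji; rewrite mderivZ mderivXU (negPf nji) scaler0.
rewrite linear_sum; under [RHS]eq_bigr => a _ do rewrite linear_sum.
under [RHS]eq_bigr => a _ do under eq_bigr => b _ do rewrite linearZ rmorphM /=.
rewrite -sum_dual_gram; apply: eq_bigr => i _; apply: eq_bigr => j _.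
by rewrite dual_form_delta // !dzf.
Qed.

End Chart.

Section Homogeneous.
Context (K : numFieldType) (n : nat).
Implicit Types (F : {mpoly K[n]}) (A : 'M[K]_n).

Lemma linsubst_eval A F :
  linsubst A F = poly_eval (fun i => \sum_j A j i *: 'X_j) F.
Proof.
rewrite /linsubst comp_mpoly_eval; apply: eq_poly_eval => i.
by rewrite tnth_mktuple.
Qed.

Lemma ev_linsubst A q F : ev q (linsubst A F) = ev (q *m A) F.
Proof.
rewrite /ev /linsubst comp_mpoly_meval; apply: meval_eq => i.
rewrite tnth_mktuple mxE (raddf_sum (meval _)); apply: eq_bigr => j _.
by rewrite /= mevalZ mevalXU mulrC.
Qed.

Lemma poly_evalZ_homog (A : comAlgType K) (y : 'I_n -> A) F D t :
  F \is D.-homog -> poly_eval (fun i => t *: y i) F = t ^+ D *: poly_eval y F.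
Proof.
move=> /dhomogP hF; rewrite !poly_evalE scaler_sumr big_seq [RHS]big_seq.
apply: eq_bigr => m /hF mD; rewrite scalerA mulrC -scalerA; congr (_ *: _).
rewrite -mD /= mdegE; elim/big_rec3: _ => [|i x y' z _ ->].
  by rewrite expr0 scale1r.
by rewrite exprZn exprD -scalerAl -scalerAr scalerA mulrC.
Qed.

Lemma evZ_homog q F D t : F \is D.-homog -> ev (t *: q) F = t ^+ D * ev q F.
Proof.
move=> /dhomogP hF; rewrite /ev !mevalE mulr_sumr big_seq [RHS]big_seq.
apply: eq_bigr => m /hF mD; rewrite mulrCA; congr (_ * _).
rewrite -mD /= mdegE; elim/big_rec3: _ => [|i x y z _ ->].
  by rewrite expr0 mul1r.
by rewrite mxE exprMn exprD mulrACA.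
Qed.

Lemma dhomog_mderiv F D i : F \is D.+1.-homog -> F^`M(i) \is D.-homog.
Proof.
move=> /dhomogP hF; apply/dhomogP => m; rewrite mcoeff_msupp mcoeff_deriv => nz.
have /hF : (m + U_(i))%MM \in msupp F.
  by rewrite mcoeff_msupp; apply: contraNneq nz => ->; rewrite mul0rn.
by rewrite /= mdegD mdeg1 addn1 => -[].
Qed.

Lemma dhomog0_const F : F \is 0.-homog -> F = (F@_0)%:MP.
Proof.
move=> /dhomogP hF; apply/mpolyP => m; rewrite mcoeffC.
have [->|nm] := eqVneq m 0%MM; first by rewrite mulr1.
rewrite mulr0; apply/eqP; apply: contraT; rewrite -mcoeff_msupp => /hF /eqP.
by rewrite mdeg_eq0 (negPf nm).
Qed.

Lemma dhomog1_linear F : F \is 1.-homog -> F = \sum_i F@_U_(i) *: 'X_i.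
Proof.
move=> /dhomogP hF; apply: mdeg_le1_linear => [|m].
  apply/eqP; apply: contraT; rewrite -mcoeff_msupp => /hF /=.
  by rewrite mdeg0.
by rewrite -mcoeff_msupp => /hF /= ->.
Qed.

Lemma sum_var_mderiv F D : F \is D.-homog ->
  \sum_i 'X_i * F^`M(i) = D%:R *: F.
Proof.
move=> /dhomogP hF; rewrite [F in RHS]mpolyE.
transitivity (\sum_i \sum_(m <- msupp F) F@_m *: ((m i)%:R *: 'X_[m])).
  apply: eq_bigr => i _; rewrite {1}(mpolyE F) (linear_sum (mderiv i))
    mulr_sumr.
  apply: eq_bigr => m _; rewrite linearZ /= -scalerAr mderivX; congr (_ *: _).
  have [->|mi] := eqVneq (m i) 0%N; first by rewrite !scale0r mulr0.
  by rewrite -scalerAr -mpolyXD -mnm_split.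
rewrite exchange_big scaler_sumr big_seq [RHS]big_seq;
  apply: eq_bigr => m /hF mD.
rewrite -scaler_sumr -scaler_suml scalerA mulrC -scalerA; congr (_ *: _).
by rewrite -natr_sum -mdegE mD.
Qed.

Lemma ev_mderiv2B q (F H : {mpoly K[n]}) a b i j :
  ev q (a *: F - b *: H)^`M(i)^`M(j) =
  a * ev q F^`M(i)^`M(j) - b * ev q H^`M(i)^`M(j).
Proof. by rewrite !(mderivB, mderivZ) /ev mevalB !mevalZ. Qed.

Lemma mcoeff_zform (Z : 'M[K]_n) a j : (zform Z a)@_U_(j) = Z a j.
Proof.
rewrite /zform raddf_sum (bigD1 j) //= mcoeffZ mcoeffXU eqxx mulr1 big1 ?addr0
  //.
by move=> i nij; rewrite mcoeffZ mcoeffXU (negPf nij) mulr0.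
Qed.

Lemma linsubst_zform A (Z : 'M[K]_n) a : linsubst A (zform Z a) = zform (Z *m
  A^T) a.
Proof.
rewrite linsubst_eval /zform (linear_sum (poly_eval _)).
under eq_bigr => i _ do rewrite linearZ /= poly_evalX scaler_sumr.
rewrite exchange_big; apply: eq_bigr => j _ /=.
rewrite mxE scaler_suml; apply: eq_bigr => i _.
by rewrite scalerA mxE.
Qed.

End Homogeneous.

(** * Degrees of basic invariants *)

Section InvariantTheory.
Context (R : realType) (gT : finGroupType) (G : {group gT}) (n : nat).
Local Notation C := (R[i]).
Context (rG : mx_representation C G n.+1).
Local Notation S := (invariants rG).

Lemma inv_val_linear : linear (inv_val (rG := rG)).
Proof. by []. Qed.

Lemma inv_val_multiplicative : multiplicative (inv_val (rG := rG)).
Proof. by []. Qed.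

HB.instance Definition _ :=
  GRing.isLinear.Build C S {mpoly C[n.+1]} *:%R (inv_val (rG := rG))
    inv_val_linear.
HB.instance Definition _ :=
  GRing.isMultiplicative.Build S {mpoly C[n.+1]} (inv_val (rG := rG))
    inv_val_multiplicative.

Lemma inv_eval (x : 'I_n.+1 -> S) P :
  inv_val (poly_eval x P) = poly_eval (fun a => inv_val (x a)) P.
Proof.
exact (poly_eval_morph (inv_val (rG := rG) : {lrmorphism S -> {mpoly C[n.+1]}})
  x P).
Qed.

Lemma inv_linsubst (F : S) h : h \in G -> linsubst (rG h^-1%g) F = F.
Proof. by move=> hG; case: F => F /= /inv_predP /(_ _ hG). Qed.

Lemma inv_linsubst' (F : S) h : h \in G -> linsubst (rG h) F = F.
Proof. by move=> hG; rewrite -{1}(invgK h) inv_linsubst ?groupV. Qed.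

Lemma val_inj_inv (f h : S) : inv_val f = inv_val h -> f = h.
Proof. exact: val_inj. Qed.

End InvariantTheory.

Section DegreeFacts.
Context (R : realType) (gT : finGroupType) (G : {group gT}) (n : nat).
Local Notation C := (R[i]).
Context (rG : mx_representation C G n.+1).
Local Notation S := (invariants rG).
Context (VR : real_form rG) (I : invariant_form VR).
Local Notation B := (I : 'M[C]_n.+1).
Implicit Types (F : S) (q : 'rV[C]_n.+1) (h : gT).

Lemma rG_gram h : h \in G -> rG h *m B *m (rG h)^T = B.
Proof.
move=> hG; apply/matrixP => i j; rewrite -!bilin_delta -(gram_inv I _ _ hG).
by rewrite /bilin trmx_mul !mulmxA.
Qed.

Lemma rG_gram_inv h : h \in G -> (rG h)^T *m invmx B *m rG h = invmx B.
Proof. by move=> hG; apply: invmx_inv (gram_unit I) (rG_gram hG). Qed.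

Lemma ev_mderiv_inv F q h j : h \in G ->
  ev q F^`M(j) = \sum_i rG h j i * ev (q *m rG h) F^`M(i).
Proof.
move=> hG; rewrite -{1}(inv_linsubst' F hG) linsubst_mderiv /ev.
rewrite (raddf_sum (meval _)); apply: eq_bigr => i _.
by rewrite /= mevalZ -!/(ev _ _) ev_linsubst.
Qed.

Lemma ev_mderiv2_inv F h i j : h \in G ->
  ev 0 F^`M(i)^`M(j) =
  \sum_k \sum_l rG h i k * rG h j l * ev 0 F^`M(k)^`M(l).
Proof.
move=> hG; rewrite -{1}(inv_linsubst' F hG) linsubst_mderiv.
rewrite (raddf_sum (mderiv j)) /ev (raddf_sum (meval _)); apply: eq_bigr => k _.
rewrite /= mderivZ linsubst_mderiv mevalZ (raddf_sum (meval _)) mulr_sumr.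
apply: eq_bigr => l _; rewrite /= mevalZ -!/(ev _ _) ev_linsubst mul0mx.
by rewrite mulrA.
Qed.

Hypothesis irrG : mx_irreducible rG.

(** The line of [w] is a nonzero submodule, hence everything by irreducibility; then G acts
    trivially. *)
Lemma invariant_vector_trivial (w : 'rV[C]_n.+1) : mx_faithful rG ->
  w != 0 -> (forall h, h \in G -> w *m rG h = w) -> G :=: 1%g.
Proof.
move=> faithG nw fixw; have /mx_irrP[_ irr] := irrG.
have mod : mxmodule rG <<w>>%MS.
  rewrite (eqmx_module _ (genmxE w)); apply/mxmoduleP => h hG.
  by rewrite fixw.
have : row_full <<w>>%MS.
  by apply: irr mod _; rewrite -submx0 genmxE submx0.
rewrite -sub1mx genmxE => /submxP[D D1].
apply/trivgP; apply: subset_trans faithG; apply/subsetP => h hG.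
by apply/rkerP; split=> //; rewrite -[rG h]mul1mx D1 -mulmxA fixw.
Qed.

(** The invariance of H and of the form makes H B^-1 commute with G; after subtracting an eigenvalue
    it is singular, so zero by Schur's lemma. *)
Lemma scalar_of_invariant (H : 'M[C]_n.+1) :
  (forall h, h \in G -> rG h *m H *m (rG h)^T = H) -> exists l, H = l *: B.
Proof.
move=> invH; pose f := H *m invmx B.
have /closed_rootP[l /=] : size (char_poly f) != 1%N by rewrite size_char_poly.
rewrite -eigenvalue_root_char => evl; exists l.
have cent : centgmx rG (f - l%:M).
  apply/centgmxP => h hG; rewrite mulmxBl mulmxBr scalar_mxC; congr (_ - _).
  rewrite /f mulmxA -[in LHS](invH h hG) -!mulmxA.
  by rewrite (mulmxA _ _ (rG h)) rG_gram_inv.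
have f0 : f - l%:M = 0.
  apply/eqP; apply: contraT => /(mx_Schur irrG cent).
  rewrite -row_free_unit -kermx_eq0; move: evl; rewrite /eigenvalue /eigenspace.
  by move=> /negPf ->.
have : H = f *m B by rewrite /f mulmxKV // gram_unit.
by move=> ->; rewrite -(subrK l%:M f) f0 add0r mul_scalar_mx.
Qed.

Lemma quadratic_eq0 (F : {mpoly C[n.+1]}) : F \is 2.-homog ->
  (forall i j, ev 0 F^`M(i)^`M(j) = 0) -> F = 0.
Proof.
move=> hF F0; have F2 i j : F^`M(i)^`M(j) = 0.
  have /dhomog0_const Fc := dhomog_mderiv j (dhomog_mderiv i hF).
  by have := F0 i j; rewrite Fc /ev mevalC => ->; rewrite mpolyC0.
apply/mpolyP => m; rewrite mcoeff0; apply/eqP; apply: contraT => nz.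
have := mderiv2_eq0_mdeg F2 nz.
by move: nz; rewrite -mcoeff_msupp => /(dhomog_mf hF) /= ->.
Qed.

Context (d : 'I_n.+1 -> nat) (x : basic_invariants rG d).
Implicit Types (a b : 'I_n.+1).

Lemma basic_neq a (P : {mpoly C[n.+1]}) : P@_U_(a) = 0 -> x a != poly_eval x P.
Proof.
move=> Pa; apply/eqP; rewrite -(poly_evalX x a) => /poly_eval_inj eP.
by move/eqP: Pa; rewrite -eP mcoeffXU eqxx oner_eq0.
Qed.

Lemma basic_neq0 a : x a != 0.
Proof. by rewrite -(raddf0 (poly_eval x)) basic_neq ?mcoeff0. Qed.

Lemma basic_val_neq0 a : inv_val (x a) != 0.
Proof. by apply: contraNneq (basic_neq0 a) => xa; apply/eqP/val_inj_inv. Qed.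

Lemma basic_degree_gt0 a : (0 < d a)%N.
Proof.
rewrite lt0n; apply/eqP => da.
have := basic_homog x a; rewrite da => /dhomog0_const xc.
have Pa : (((inv_val (x a))@_0)%:MP_[n.+1])@_U_(a) = 0.
  by rewrite mcoeffC mnm1_eq0 mulr0.
by case/eqP: (basic_neq Pa); apply: val_inj_inv;
  rewrite {1}xc poly_evalC linearZ rmorph1 /= alg_mpolyC.
Qed.

(** A basic invariant of degree 1 would be a nonzero invariant linear form, and the form I would
    turn it into a nonzero fixed vector. *)
Lemma basic_degree_ge2 a : mx_faithful rG -> G :!=: 1%g -> (1 < d a)%N.
Proof.
move=> faithG ntG; rewrite ltn_neqAle basic_degree_gt0 andbT eq_sym.
apply/eqP => da; have h1 := basic_homog x a; rewrite da in h1.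
pose phi : 'rV[C]_n.+1 := \row_i ev 0 (inv_val (x a))^`M(i).
case/eqP: ntG; apply: (@invariant_vector_trivial (phi *m invmx B)) => //.
  apply/eqP => /(congr1 (mulmx^~ B)); rewrite mulmxKV ?gram_unit // mul0mx.
  move=> phi0; have := basic_val_neq0 a; rewrite -[inv_val (x a)]scale1r.
  rewrite -(sum_var_mderiv h1) big1 ?eqxx // => i _.
  have /dhomog0_const := dhomog_mderiv i h1.
  have /rowP/(_ i) := phi0; rewrite !mxE => phi0i xc.
  by move: phi0i; rewrite xc /ev mevalC => ->; rewrite mpolyC0 mulr0.
move=> h hG; have phih : phi *m (rG h)^T = phi.
  apply/rowP => j; rewrite !mxE (ev_mderiv_inv _ _ _ hG) mul0mx.
  by apply: eq_bigr => i _; rewrite !mxE mulrC.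
by rewrite -{2}(rG_gram_inv hG) !mulmxA phih.
Qed.

(* Schur's lemma: all invariant quadratic forms are proportional to I. *)
Lemma basic_degree2_unique a b : d a = 2%N -> d b = 2%N -> a = b.
Proof.
move=> da db; apply/eqP; apply: contraT => nab.
pose H e := \matrix_(i, j) ev 0 (inv_val (x e))^`M(i)^`M(j).
have Hl e : exists l, H e = l *: B.
  apply: scalar_of_invariant => h hG; apply/matrixP => i j.
  rewrite !mxE (ev_mderiv2_inv _ _ _ hG) exchange_big; apply: eq_bigr => l _ /=.
  rewrite !mxE mulr_suml; apply: eq_bigr => k _; rewrite !mxE.
  by rewrite mulrAC.
have [la Ha] := Hl a; have [lb Hb] := Hl b.
have HE e i j : ev 0 (inv_val (x e))^`M(i)^`M(j) = H e i j by rewrite mxE.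
have l0 e l : d e = 2%N -> H e = l *: B -> l != 0.
  move=> de He; apply: contraNneq (basic_val_neq0 e) => l0; apply/eqP.
  apply: quadratic_eq0; first by rewrite -de basic_homog.
  by move=> i j; rewrite HE He l0 scale0r mxE.
(* Both Hessians at 0 are multiples of the Gram matrix and this combination cancels them; as [lb] is
   nonzero, this contradicts algebraic independence. *)
have : inv_val (lb *: x a - la *: x b) = 0.
  apply: quadratic_eq0.
    by apply: rpredB; apply: rpredZ; [rewrite -da|rewrite -db];
      apply: basic_homog.
  have -> : inv_val (lb *: x a - la *: x b) =
    lb *: inv_val (x a) - la *: inv_val (x b) by [].
  move=> i j.
  rewrite (ev_mderiv2B 0 (inv_val (x a)) (inv_val (x b)) lb la i j).
  apply: (etrans (congr2 (fun s t => lb * s - la * t) (HE a i j) (HE b i j))).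
  by rewrite Ha Hb !mxE mulrCA subrr.
move=> E0; have : poly_eval x (lb *: 'X_a - la *: 'X_b) = 0.
  rewrite (raddfB (poly_eval x)) /= !poly_evalZ !poly_evalX.
  exact: (@val_inj_inv _ _ _ _ _ _ 0 E0).
move=> /coord_alg_indep /(congr1 (mcoeff U_(a)%MM)).
rewrite mcoeffB !mcoeffZ !mcoeffXU eqxx [b == a]eq_sym (negPf nab) mulr0 mulr1.
by rewrite subr0 mcoeff0 => /eqP; rewrite (negPf (l0 _ _ db Hb)).
Qed.

(** Evaluating the weight D part of P at x gives the degree D component of F, which is F; evaluation
    at x is injective. *)
Lemma coord_poly_weight F D : inv_val F \is D.-homog ->
  {in msupp (coord_poly x F), forall m, wdeg d m = D}.
Proof.
move=> hF; set P := coord_poly x F.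
have homx (m : 'X_{1..n.+1}) :
    poly_eval (fun a => inv_val (x a)) 'X_[m] \is (wdeg d m).-homog.
  rewrite poly_evalXm /wdeg; elim/big_rec2: _ => [|i F' k _ IH];
    first exact: dhomog1.
  by apply: dhomogM IH; apply/dhomogMn/basic_homog.
suff <- : wpart d 0 D P = P.
  move=> m; rewrite mcoeff_msupp mcoeff_wpart addn0.
  by case: ifPn => [/eqP|_]; rewrite ?eqxx.
apply: (@poly_eval_inj _ _ _ x); rewrite coord_polyK; apply: val_inj_inv.
rewrite -(pihomog_dE hF) -(coord_polyK x F) -/P !inv_eval.
rewrite [RHS](congr1 _ (poly_eval_supp _ P)) (linear_sum (pihomog _ _)).
rewrite /wpart (linear_sum (poly_eval _)) big_mkcond /=; apply: eq_bigr => m _.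
rewrite linearZ /= addn0; case: eqP => [wm|/eqP wm].
  by rewrite linearZ /= pihomog_dE // -wm.
by rewrite linearZ /= (pihomog_ne0 wm (homx m)) scaler0.
Qed.

End DegreeFacts.

(** * Admissible triplets and the duality of degrees *)

Section Admissible.
Context (R : realType) (gT : finGroupType) (G : {group gT}) (n : nat).
Local Notation C := (R[i]).
Context (rG : mx_representation C G n.+1).
Local Notation top := (@ord_max n).
Context (VR : real_form rG) (I : invariant_form VR).
Local Notation B := (I : 'M[C]_n.+1).
Hypotheses (faithG : mx_faithful rG) (ntG : G :!=: 1%g).
Hypothesis irrG : mx_irreducible rG.
Context (d : 'I_n.+1 -> nat) (g : gT) (zeta : C) (q : 'rV[C]_n.+1).
Hypothesis adm : admissible rG d g zeta q.
Implicit Types (x y : basic_invariants rG d) (a b i j : 'I_n.+1).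
Implicit Types (Z : 'M[C]_n.+1).
Local Notation A := (rG g^-1%g).

Lemma adm_basic : exists x : basic_invariants rG d, True.
Proof. by have [x _] := adm_jacobian adm; exists x. Qed.

Lemma adm_ge2 a : (1 < d a)%N.
Proof.
by have [x _] := adm_basic; apply: (basic_degree_ge2 I irrG x a faithG ntG).
Qed.

Lemma adm_gt0 a : (0 < d a)%N. Proof. exact: ltnW (adm_ge2 a). Qed.

Lemma adm_le_top a : (d a <= d top)%N.
Proof.
by have [x _] := adm_basic; apply: (basic_sorted x); rewrite -ltnS ltn_ord.
Qed.

Lemma zeta_neq0 : zeta != 0.
Proof.
apply/eqP => z0; have /eqP := prim_expr_order (adm_root adm); rewrite z0.
by rewrite expr0n gtn_eqF ?adm_gt0 // eq_sym oner_eq0.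
Qed.

Lemma eigen_inv : q *m A = zeta^-1 *: q.
Proof.
have gG := adm_group adm.
rewrite -{1}(scale1r q) -(mulVf zeta_neq0) -scalerA -(adm_eigen adm).
rewrite -scalemxAl -mulmxA -repr_mxM ?groupV // mulgV repr_mx1 mulmx1.
by [].
Qed.

Definition zeta_rows Z : 'M[C]_n.+1 :=
  \matrix_(a, j) (zeta ^+ (d a - 1) * Z a j).

Lemma g_homogeneousP Z :
  g_homogeneous rG d g zeta Z <-> Z \in unitmx /\ Z *m A^T = zeta_rows Z.
Proof.
split=> -[uZ hZ]; split=> //.
  apply/matrixP => a j; rewrite -mcoeff_zform -linsubst_zform.
  by have /= -> : linsubst A (zform Z a) = _ := hZ a;
    rewrite mcoeffZ mcoeff_zform mxE.
move=> a; rewrite /Defs.gact linsubst_zform hZ /zform scaler_sumr.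
by apply: eq_bigr => j _; rewrite mxE scalerA.
Qed.

Definition jac x : 'M[C]_n.+1 := \matrix_(a, i) ev q (inv_val (x a))^`M(i).

Lemma jac_dz x Z : \matrix_(a, b) ev q (dz Z b (x a)) = jac x *m invmx Z.
Proof.
apply/matrixP => a b; rewrite !mxE /ev /dz (raddf_sum (meval _)).
by apply: eq_bigr => i _; rewrite /= mevalZ mxE mulrC.
Qed.

(** Admissibility grants this for one set y of basic invariants only; writing y as polynomials in x
    makes the Jacobian of x a factor of that of y. *)
Lemma jac_unit x : jac x \in unitmx.
Proof.
have [y [Z uZ]] := adm_jacobian adm; rewrite jac_dz unitmx_mul => /andP[uy _].
pose P a := coord_poly x (y a).
pose L := \matrix_(a, b) ev q (poly_eval (fun e => inv_val (x e)) (P a)^`M(b)).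
have : jac y = L *m jac x.
  apply/matrixP => a i; rewrite !mxE -{1}(coord_polyK x (y a)) inv_eval.
  rewrite mderiv_poly_eval /ev (raddf_sum (meval _)); apply: eq_bigr => b _.
  by rewrite !mxE /= mevalM.
by move=> jE; move: uy; rewrite jE unitmx_mul => /andP[].
Qed.

(** The differentials of the x^a at q provide a g-homogeneous basis, compatible with x by
    construction. The derivatives are homogeneous of degree d_a - 1 and q is an eigenvector, whence
    the exponent of zeta. *)
Lemma jac_homogeneous x : g_homogeneous rG d g zeta (jac x).
Proof.
apply/g_homogeneousP; split; first exact: jac_unit.
apply/matrixP => a j; rewrite !mxE.
rewrite (ev_mderiv_inv (x a) q j (groupVr (adm_group adm))) eigen_inv mulr_sumr.
apply: eq_bigr => i _; rewrite !mxE.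
have hD : inv_val (x a) \is (d a - 1).+1.-homog.
  by rewrite subn1 prednK ?adm_gt0 // basic_homog.
rewrite (evZ_homog _ _ (dhomog_mderiv i hD)) mulrCA exprVn mulVKf.
  by rewrite mulrC.
by rewrite expf_neq0 // zeta_neq0.
Qed.

Lemma jac_compatible x : compatible x (jac x) q.
Proof.
move=> a b; have /matrixP/(_ a b) := jac_dz x (jac x).
by rewrite mulmxV ?jac_unit // !mxE.
Qed.

(** Invariance of I^* under g multiplies the entry by zeta^(d_a + d_b - 2). If it is nonzero, d_n
    divides d_a + d_b - 2, which lies strictly between 0 and 2 d_n. *)
Lemma dual_gram_weight Z a b : g_homogeneous rG d g zeta Z ->
  dual_gram Z B a b != 0 -> (d a + d b = d top + 2)%N.
Proof.
move=> /g_homogeneousP[uZ ZA]; rewrite (dual_gramE _ (gram_trmx I) (gram_unit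
  I)).
set M := _ *m _; have ME : M a b = zeta ^+ ((d a - 1) + (d b - 1)) * M a b.
  rewrite /M -{1}(rG_gram_inv I (groupVr (adm_group adm))).
  have -> : Z *m (A^T *m invmx B *m A) *m Z^T =
      zeta_rows Z *m invmx B *m (zeta_rows Z)^T.
    by rewrite -ZA trmx_mul trmxK !mulmxA.
  rewrite !mxE mulr_sumr; apply: eq_bigr => j _; rewrite !mxE mulr_suml.
  rewrite mulr_suml mulr_sumr; apply: eq_bigr => i _; rewrite !mxE exprD.
  by ring.
move=> nz; have : zeta ^+ ((d a - 1) + (d b - 1)) = 1.
  by apply: (mulIf nz); rewrite mul1r -ME.
move/eqP; rewrite -(prim_order_dvd (adm_root adm)) => /dvdnP[k kE].
move: kE (adm_ge2 a) (adm_ge2 b) (adm_le_top a) (adm_le_top b).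
by case: k => [|[|k]]; rewrite ?mulSn ?mul0n; lia.
Qed.

(* A nonzero term of the Leibniz expansion of det M pairs each degree d_i with
   d_n + 2 - d_i; as the degrees are sorted, the pairing is i |-> n + 1 - i. *)
Lemma degree_duality a : (d a + d (rev_ord a) = d top + 2)%N.
Proof.
have [x _] := adm_basic.
pose M := dual_gram (jac x) B.
have uM : M \in unitmx.
  exact: (dual_gram_unit (jac_unit x) (gram_trmx I) (gram_unit I)).
have [s sM] : exists s : 'S_n.+1, forall i, M i (s i) != 0.
  apply: contrapT => ns; move: uM; rewrite unitmxE unitfE => /negP[].
  rewrite /determinant big1 // => s _.
  have [->|/prodf_neq0 sM] := eqVneq (\prod_i M i (s i)) 0;
    first by rewrite mulr0.
  by case: ns; exists s => i; apply: sM.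
have sd i : (d i + d (s i) = d top + 2)%N.
  exact: dual_gram_weight (jac_homogeneous x) (sM i).
pose e i := (d top + 2 - d (rev_ord i))%N.
have eE : e =1 d \o (s \o @rev_ord n.+1).
  by move=> i; rewrite /e -(sd (rev_ord i)) addKn.
have sorted_enum f : (forall i j : 'I_n.+1, i <= j -> f i <= f j)%N ->
    sorted leq (map f (enum 'I_n.+1)).
  move=> hf; rewrite sorted_map; apply: (sub_sorted (e := relpre val leq)).
    by move=> i j; apply: hf.
  by rewrite -sorted_map val_enum_ord iota_sorted.
(* Both lists are nondecreasing and [e] is [d] composed with a permutation, so uniqueness of sorting
   identifies them. *)
have /eq_in_map/(_ a) : map d (enum 'I_n.+1) = map e (enum 'I_n.+1).
  apply: (sorted_eq leq_trans anti_leq).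
  - exact/sorted_enum/(basic_sorted x).
  - apply: sorted_enum => i j ij; apply: leq_sub2l; apply: (basic_sorted x).
    by rewrite /= leq_sub2l.
  rewrite (eq_map eE) map_comp perm_sym; apply: perm_map.
  apply: uniq_perm; rewrite ?enum_uniq //.
    rewrite map_inj_uniq ?enum_uniq //.
    exact: inj_comp perm_inj rev_ord_inj.
  move=> i; rewrite mem_enum; apply/mapP; exists (rev_ord (s^-1%g i)).
    by rewrite mem_enum.
  by rewrite /= rev_ordK permKV.
rewrite mem_enum => -> //; rewrite /e subnK //.
by rewrite (leq_trans (adm_le_top _)) // leq_addr.
Qed.

(** If d_a = d_n, then the duals of a and of n both have degree 2, and there is only one basic
    invariant of that degree. *)
Lemma degree_lt_top a : a != top -> (d a < d top)%N.
Proof.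
move=> na; rewrite ltn_neqAle adm_le_top andbT; apply: contraNneq na => da.
have [x _] := adm_basic; apply/eqP/rev_ord_inj.
have d2 b : d b = d top -> d (rev_ord b) = 2%N.
  by move=> db; have := degree_duality b; rewrite db => /addnI.
by apply: (basic_degree2_unique I irrG x); apply: d2.
Qed.

Definition expansion x Z a : {mpoly C[n.+1]} := taylor Z q (inv_val (x a)).

(** Multiplying each variable of index i by zeta^(d_i) amounts, in the chart at q, to applying g^-1
    and then the scalar zeta. The invariant x^a only feels the scalar and gets the factor
    zeta^(d_a), while a monomial of weight w gets zeta^w. *)
Lemma expansion_weight x Z a (m : 'X_{1..n.+1}) : g_homogeneous rG d g zeta Z ->
  (expansion x Z a)@_m != 0 -> wdeg d m = d a %[mod d top].
Proof.
move=> /g_homogeneousP[uZ ZA] nz; apply/eqP.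
rewrite -(eq_prim_root_expr (adm_root adm)); apply/eqP/(mulIf nz).
pose L i : {mpoly C[n.+1]} := zeta ^+ d i *: 'X_i.
have LE P : (poly_eval L P)@_m = zeta ^+ wdeg d m * P@_m.
  rewrite [in RHS](mpolyE P) (poly_eval_supp L P) !raddf_sum mulr_sumr.
  apply: eq_bigr => m' _; rewrite /= !mcoeffZ mulrCA; congr (_ * _).
  have -> : poly_eval L 'X_[m'] = zeta ^+ wdeg d m' *: 'X_[m'].
    rewrite poly_evalXm mpolyXE_id /wdeg.
    elim/big_rec3: _ => [|i X k Y _ ->]; first by rewrite expr0 scale1r.
    by rewrite /L exprZn -exprM -scalerAl -scalerAr scalerA -exprD.
  rewrite mcoeffZ mcoeffX; case: eqP => [->|_] //=.
  by rewrite !mulr0.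
rewrite -LE -mcoeffZ; congr (_@__); rewrite /expansion /taylor.
rewrite (poly_eval_morph (poly_eval L)).
have AZ : A^T *m invmx Z = invmx Z *m diag_mx (\row_a zeta ^+ (d a - 1)).
  rewrite -[LHS](mulKmx uZ) (mulmxA Z) ZA; congr (_ *m _).
  rewrite -[zeta_rows Z](_ : diag_mx (\row_a zeta ^+ (d a - 1)) *m Z = _).
    by rewrite -mulmxA mulmxV // mulmx1.
  by apply/matrixP => b j; rewrite mul_diag_mx !mxE.
have chartL i : poly_eval L (chart Z q i) =
    zeta *: \sum_j A j i *: chart Z q j.
  rewrite /chart linearD /= poly_evalC linear_sum /= alg_mpolyC.
  under [in RHS]eq_bigr => j _ do rewrite scalerDr.
  rewrite big_split scalerDr /=; congr (_ + _).
    have /rowP/(_ i) := eigen_inv; rewrite !mxE => qi.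
    rewrite -(_ : zeta * (\sum_j q 0 j * A j i) = q 0 i).
      rewrite mpolyCM mul_mpolyC (raddf_sum (@mpolyC _ _)); congr (_ *: _).
      by apply: eq_bigr => j _; rewrite /= mulrC mpolyCM mul_mpolyC.
    by rewrite qi mulVKf // zeta_neq0.
  under [in RHS]eq_bigr => j _ do rewrite scaler_sumr.
  rewrite exchange_big scaler_sumr; apply: eq_bigr => b _ /=.
  rewrite linearZ /= poly_evalX /L scalerA.
  under [in RHS]eq_bigr => j _ do rewrite scalerA.
  rewrite -scaler_suml scalerA; congr (_ *: _).
  have /matrixP/(_ i b) := AZ; rewrite mul_mx_diag !mxE.
  under eq_bigr => j _ do rewrite mxE.
  move=> ->; rewrite mulrCA -exprS subn1 prednK ?adm_gt0 //.
rewrite (eq_poly_eval chartL) (poly_evalZ_homog _ _ (basic_homog x a)).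
apply: (congr1 ( *:%R _)).
apply: (etrans _ (congr1 (poly_eval _) (inv_linsubst (x a) (adm_group adm)))).
apply: (etrans _ (esym (congr1 (poly_eval _) (linsubst_eval _ _)))).
apply: (etrans _ (esym (poly_eval_morph (poly_eval _) _ _))).
apply: eq_poly_eval => i /=.
by rewrite linear_sum; apply: eq_bigr => j _; rewrite linearZ /= poly_evalX.
Qed.

End Admissible.

Section Generic.
Context (K : numFieldType) (n : nat).
Implicit Types (P : {mpoly K[n]}) (m : 'X_{1..n}).

Lemma mcoeff_bounded_sum k (p : pred 'X_{1..n}) (f : 'X_{1..n} -> K) m :
  (\sum_(e : 'X_{1..n < k} | p e) f e *: 'X_[e])@_m =
  if p m && (mdeg m < k)%N then f m else 0.
Proof.
rewrite raddf_sum /=; under eq_bigr => e _ do rewrite mcoeffZ mcoeffX.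
case: ifPn => [/andP[pm mk]|npm].
  rewrite (bigD1 (BMultinom mk)) //= eqxx mulr1 big1 ?addr0 // => e /andP[_ ne].
  case: eqP => [em|_]; last by rewrite mulr0.
  by case/eqP: ne; apply: val_inj.
rewrite big1 // => e pe; case: eqP => [em|_]; last by rewrite mulr0.
by case/negP: npm; rewrite -em pe bmdeg.
Qed.

Lemma zform_mderiv (Z : 'M[K]_n) a i : (zform Z a)^`M(i) = (Z a i)%:MP.
Proof.
rewrite /zform (linear_sum (mderiv i)) (bigD1 i) //= mderivZ mderivXU eqxx.
rewrite big1 ?addr0 => [|j nji]; first by rewrite -mul_mpolyC mulr1.
by rewrite mderivZ mderivXU (negPf nji) scaler0.
Qed.

Lemma zform_homog (Z : 'M[K]_n) a : zform Z a \is 1.-homog.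
Proof.
by apply: rpred_sum => i _; apply: rpredZ; rewrite dhomogX /= mdeg1.
Qed.

Lemma zform1 a : zform 1%:M a = 'X_a :> {mpoly K[n]}.
Proof.
rewrite /zform (bigD1 a) //= mxE eqxx scale1r big1 ?addr0 // => j nja.
by rewrite mxE eq_sym (negPf nja) scale0r.
Qed.

Lemma poly_eval_zform_homog (Z : 'M[K]_n) P : Z \in unitmx ->
  poly_eval (zform Z) P \is 1.-homog -> P \is 1.-homog.
Proof.
move=> uZ /dhomog1_linear; set Q := poly_eval _ _ => QE.
have -> : P = \sum_i Q@_U_(i) *: zform (invmx Z) i.
  apply: (poly_eval_zform_inj uZ); rewrite -/Q QE linear_sum.
  apply: eq_bigr => i _; rewrite linearZ /= -QE; congr (_ *: _).
  rewrite /zform linear_sum -(sum_invmx_zform uZ); apply: eq_bigr => a _.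
  by rewrite linearZ /= poly_evalX.
by apply: rpred_sum => i _; apply: rpredZ; apply: zform_homog.
Qed.

Lemma coord_poly_eval (A : comAlgType K) (y : coordinates A n)
    k (P : {mpoly K[k]}) (z : 'I_k -> A) :
  coord_poly y (poly_eval z P) = poly_eval (fun a => coord_poly y (z a)) P.
Proof.
apply: (poly_eval_inj (x := y)); rewrite coord_polyK.
rewrite (poly_eval_morph (poly_eval y)); apply: eq_poly_eval => a /=.
by rewrite coord_polyK.
Qed.

Lemma coord_poly_coord (A : comAlgType K) (y : coordinates A n) a :
  coord_poly y (y a) = 'X_a.
Proof. by apply: (poly_eval_inj (x := y)); rewrite coord_polyK poly_evalX. Qed.

Lemma coord_polyD (A : comAlgType K) (y : coordinates A n) f h :
  coord_poly y (f + h) = coord_poly y f + coord_poly y h.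
Proof.
by apply: (poly_eval_inj (x := y)); rewrite poly_evalD !coord_polyK.
Qed.

Lemma coord_polyZ (A : comAlgType K) (y : coordinates A n) c f :
  coord_poly y (c *: f) = c *: coord_poly y f.
Proof.
by apply: (poly_eval_inj (x := y)); rewrite poly_evalZ !coord_polyK.
Qed.

Lemma coord_poly_sum (A : comAlgType K) (y : coordinates A n) I (r : seq I) F :
  coord_poly y (\sum_(i <- r) F i) = \sum_(i <- r) coord_poly y (F i).
Proof.
apply: (big_morph _ (coord_polyD y)).
by rewrite -(scale0r 0) coord_polyZ scale0r.
Qed.

Lemma taylor_prodB (Z : 'M[K]_n) q (F : 'I_n -> {mpoly K[n]}) (c : 'I_n -> K) m
  :
  taylor Z q (\prod_i (F i - (c i)%:MP) ^+ m i) =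
  \prod_i (taylor Z q (F i) - (c i)%:MP) ^+ m i.
Proof.
rewrite /taylor rmorph_prod; apply: eq_bigr => i _.
by rewrite rmorphXn /= rmorphB /= poly_evalC alg_mpolyC.
Qed.

End Generic.

(** * The map psi and good invariants *)

Section TaylorExpansion.
Context (R : realType) (gT : finGroupType) (G : {group gT}) (n : nat).
Local Notation C := (R[i]).
Context (rG : mx_representation C G n.+1).
Local Notation top := (@ord_max n).
Context (VR : real_form rG) (I : invariant_form VR).
Local Notation B := (I : 'M[C]_n.+1).
Hypotheses (faithG : mx_faithful rG) (ntG : G :!=: 1%g).
Hypothesis irrG : mx_irreducible rG.
Context (d : 'I_n.+1 -> nat) (g : gT) (zeta : C) (q : 'rV[C]_n.+1).
Hypothesis adm : admissible rG d g zeta q.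
Implicit Types (x y : basic_invariants rG d) (a b i j : 'I_n.+1).
Implicit Types (Z : 'M[C]_n.+1).

Let ge2 := adm_ge2 I faithG ntG irrG adm.
Let gt0 := adm_gt0 I faithG ntG irrG adm.
Let le_top := adm_le_top adm.
Let lt_top := degree_lt_top I faithG ntG irrG adm.

Lemma expansion_jac x Z :
  \matrix_(a, i) (expansion q x Z a)@_U_(i) = jac q x *m invmx Z.
Proof.
rewrite -jac_dz; apply/matrixP => a i; rewrite !mxE -(taylor_cst Z)
  -taylor_mderiv.
by rewrite mcoeff_deriv add0m mnm0E mulr1n.
Qed.

Lemma expansion_cst x Z a : (expansion q x Z a)@_0 = ev q (inv_val (x a)).
Proof. exact: taylor_cst. Qed.

Lemma ev_basic0 x Z a : g_homogeneous rG d g zeta Z -> a != top ->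
  ev q (inv_val (x a)) = 0.
Proof.
move=> hZ na; rewrite -(expansion_cst x Z); apply/eqP; apply: contraT.
move=> /(expansion_weight I faithG ntG irrG adm hZ); rewrite wdeg0 mod0n.
by rewrite modn_small ?lt_top // => d0; have := gt0 a; rewrite -d0.
Qed.

Lemma ev_euler x a : \sum_i q 0 i * ev q (inv_val (x a))^`M(i) =
  (d a)%:R * ev q (inv_val (x a)).
Proof.
have := congr1 (ev q) (sum_var_mderiv (basic_homog x a)).
rewrite /ev mevalZ (raddf_sum (meval _)) => <-.
by apply: eq_bigr => i _; rewrite /= mevalM mevalXU.
Qed.

(** By Euler's identity the Jacobian matrix sends q to the vector of the d_a x^a(q). If x^n(q)
    vanished as well, this vector would be zero, and so would q. *)
Lemma ev_basic_top x : ev q (inv_val (x top)) != 0.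
Proof.
apply: contraNneq (adm_neq0 adm) => c0; apply/eqP.
have hJ := jac_homogeneous I faithG ntG irrG adm x.
have qJ : jac q x *m q^T = 0.
  apply/colP => a; rewrite !mxE.
  transitivity ((d a)%:R * ev q (inv_val (x a))).
    by rewrite -ev_euler; apply: eq_bigr => i _; rewrite !mxE mulrC.
  have [->|na] := eqVneq a top; first by rewrite c0 mulr0.
  by rewrite (ev_basic0 x hJ na) mulr0.
apply: trmx_inj; rewrite -[LHS](mulKmx (jac_unit adm x)) qJ mulmx0.
by rewrite trmx0.
Qed.

Lemma expansion_family x Z : g_homogeneous rG d g zeta Z ->
  taylor_family d (expansion q x Z) (ev q (inv_val (x top))).
Proof.
move=> hZ; have [uZ _] := hZ; split.
- exact: ge2.
- exact: lt_top.
- exact: ev_basic_top.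
- move=> a; rewrite expansion_cst; have [->|na] := eqVneq a top; first by [].
  exact: ev_basic0 hZ na.
(* The weight is congruent to d_a modulo d_n and nonzero, because m is nonzero; for a = n the latter
   excludes weight 0. *)
- move=> a m nm nz.
  have wm : wdeg d m != 0%N by apply: contra_neq nm; apply: wdeg_eq0 gt0.
  have := expansion_weight I faithG ntG irrG adm hZ nz.
  have := divn_eq (wdeg d m) (d top).
  have := gt0 a; have [->|/lt_top da] := eqVneq a top.
    move=> _ wE; rewrite modnn => w0; move: wE wm; rewrite w0 addn0.
    move: (_ %/ _)%N => k ->.
    by case: k => [|[|k]]; rewrite ?mulSn ?mul0n; lia.
  move=> _ wE; rewrite (modn_small da) => w0; move: wE; rewrite w0.
  move: (_ %/ _)%N => k ->.
  by case: k => [|k]; rewrite ?mulSn ?mul0n; lia.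
- by rewrite expansion_jac unitmx_mul (jac_unit adm x) unitmx_inv.
Qed.

Definition gram_poly x a b := coord_poly x (IstarG I (x a) (x b)).

Lemma gram_poly_weight x a b :
  {in msupp (gram_poly x a b), forall m, wdeg d m + 2 = d a + d b}%N.
Proof.
move=> m mP.
suff -> : wdeg d m = ((d a - 1) + (d b - 1))%N.
  by have := (gt0 a); have := (gt0 b); lia.
apply: (coord_poly_weight _ mP); apply: rpred_sum => i _;
  apply: rpred_sum => j _.
apply: rpredZ; apply: dhomogM; apply: dhomog_mderiv.
  by rewrite subn1 prednK // basic_homog.
by rewrite subn1 prednK // basic_homog.
Qed.

Lemma gram_poly_expansion x Z a b : Z \in unitmx ->
  poly_eval (expansion q x Z) (gram_poly x a b) =
  \sum_i \sum_j dual_gram Z B i j *: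
    ((expansion q x Z a)^`M(i) * (expansion q x Z b)^`M(j)).
Proof.
move=> uZ; rewrite -(taylor_Istar _ uZ (gram_trmx I) (gram_unit I)).
rewrite /expansion /taylor.
apply: (etrans (esym (poly_eval_morph (poly_eval (chart Z q)) _ _))).
by rewrite -inv_eval coord_polyK.
Qed.

Lemma gram_poly_lead x Z a b : g_homogeneous rG d g zeta Z ->
  \sum_i \sum_j dual_gram Z B i j *:
    ((lead d (expansion q x Z) a)^`M(i) * (lead d (expansion q x Z) b)^`M(j)) =
  ev q (inv_val (x top)) *:
    poly_eval (lead d (expansion q x Z)) (gram_poly x a b)^`M(top).
Proof.
move=> hZ; apply: (lead_gram (expansion_family x hZ)).
- by move=> i j; apply: (dual_gram_weight faithG ntG irrG adm hZ).
- exact: gram_poly_weight.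
- by apply: gram_poly_expansion; case: hZ.
Qed.

(** Each x^i - x^i(q) starts in weight d_i, so the weight d.m part of the product, which defines
    psi, is the product of the leading parts. *)
Lemma psi_monomialE x Z (m : 'X_{1..n.+1}) : g_homogeneous rG d g zeta Z ->
  psi_monomial x Z q m =
  poly_eval (zform Z) (poly_eval (lead d (expansion q x Z)) 'X_[m]).
Proof.
move=> hZ; have [uZ _] := hZ; set u := expansion q x Z.
pose v i := u i - ((u i)@_0)%:MP.
have [_ vE] : wge d 0 (wdeg d m) (\prod_i v i ^+ m i) /\
    wpart d 0 (wdeg d m) (\prod_i v i ^+ m i) =
    \prod_i wpart d 0 (d i) (v i) ^+ m i.
  by apply: wpart_prod => i _; apply: wge_sub_cst (expansion_family x hZ) _.
have lE i : wpart d 0 (d i) (v i) = lead d u i.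
  rewrite (raddfB (wpart d 0 (d i))) /= wpart_const ?subr0 //.
  by rewrite eq_sym -lt0n.
have -> : poly_eval (lead d u) 'X_[m] = wpart d 0 (wdeg d m) (\prod_i v i ^+ m
  i).
  by rewrite vE poly_evalXm; apply: eq_bigr => i _; rewrite lE.
have vT : \prod_i v i ^+ m i =
    taylor Z q (\prod_i (inv_val (x i) - (ev q (inv_val (x i)))%:MP) ^+ m i).
  rewrite (taylor_prodB Z q (fun i => inv_val (x i))).
  by apply: eq_bigr => i _; rewrite /v expansion_cst.
pose f e := (\prod_i v i ^+ m i)@_e.
have -> : wpart d 0 (wdeg d m) (\prod_i v i ^+ m i) =
  \sum_(e : 'X_{1..n.+1 < (wdeg d m).+1} | (wdeg d e == wdeg d m)%N) f e *:
    'X_[e].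
  apply/mpolyP => e.
  rewrite (@mcoeff_bounded_sum _ _ _ (fun e => wdeg d e == wdeg d m) f).
  rewrite mcoeff_wpart addn0 ltnS; case: eqP => //= <-.
  by rewrite mdeg_le_wdeg.
rewrite (linear_sum (poly_eval _)); apply: eq_bigr => e _.
rewrite linearZ /= poly_evalXm; congr (_ *: _).
by rewrite /f vT mcoeff_taylor.
Qed.

Lemma psiE x Z f : g_homogeneous rG d g zeta Z ->
  psi x Z q f =
  poly_eval (zform Z) (poly_eval (lead d (expansion q x Z)) (coord_poly x f)).
Proof.
move=> hZ; rewrite /psi (poly_eval_supp (lead d _)) (linear_sum (poly_eval _)).
by apply: eq_bigr => m _; rewrite linearZ /= psi_monomialE.
Qed.

(** As a polynomial in y, x^a has weight d_a <= d_n, so y^n can occur in it only as a monomial by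
    itself, which is the case covered by [wpart_low]. *)
Lemma lead_change x y Z a : g_homogeneous rG d g zeta Z ->
  poly_eval (lead d (expansion q y Z)) (coord_poly y (x a)) =
  lead d (expansion q x Z) a.
Proof.
move=> hZ; have wP := coord_poly_weight (x := y) (basic_homog x a).
rewrite -(wpart_low (expansion_family y hZ) (gt0 a) wP).
  apply: (congr1 (wpart d 0 (d a))).
  apply: (etrans (esym (poly_eval_morph (poly_eval (chart Z q)) _ _))).
  apply: (congr1 (poly_eval (chart Z q))).
  by rewrite -inv_eval coord_polyK.
move=> m /wP wm; have [|mt] := eqVneq (m top) 0%N; [by left | right].
have : wdeg d (m - U_(top))%MM = 0%N.
  move: wm; rewrite {1}(mnm_split mt) wdegD wdegU.
  by have := le_top a; lia.
by move/(wdeg_eq0 gt0) => m0; rewrite (mnm_split mt) m0 addm0.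
Qed.

(** [good] involves some unspecified y; this allows its condition to be read in x itself. *)
Lemma psi_change x y Z f : g_homogeneous rG d g zeta Z ->
  psi y Z q f = psi x Z q f.
Proof.
move=> hZ; rewrite (psiE y f hZ) (psiE x f hZ).
apply: (congr1 (poly_eval (zform Z))).
have fE : coord_poly y f = poly_eval (fun a => coord_poly y (x a)) (coord_poly
  x f).
  by rewrite -coord_poly_eval coord_polyK.
apply: (etrans (congr1 (poly_eval (lead d (expansion q y Z))) fE)).
apply: (etrans (poly_eval_morph (poly_eval _) _ _)).
by apply: eq_poly_eval => a; apply: lead_change.
Qed.

Lemma psi_basic x Z a : g_homogeneous rG d g zeta Z ->
  psi x Z q (x a) = poly_eval (zform Z) (lead d (expansion q x Z) a).
Proof.
move=> hZ; rewrite (psiE x _ hZ) coord_poly_coord.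
exact: (congr1 (poly_eval (zform Z)) (poly_evalX _ _)).
Qed.

(* Goodness means that the metric I^*_G differentiated along the lowest degree
   vector field is constant in the coordinates x, a condition free of the
   admissible triplet. *)
Definition const_gram x : Prop :=
  forall a b, exists k, (gram_poly x a b)^`M(top) = k%:MP.

(** Linear leading parts have constant products under I^*, so by [gram_poly_lead] the derivative
    becomes constant after a linear substitution, and that substitution is invertible. *)
Lemma good_const_gram x : good x g zeta q -> const_gram x.
Proof.
move=> [y [Z hZ [lin _]]] a b; have [uZ _] := hZ.
set u := expansion q x Z; set c := ev q (inv_val (x top)).
have ux := expansion_family x hZ.
pose J := \matrix_(e, i) (u e)@_U_(i).
have lJ e : lead d u e = zform J e.
  have /dhomog1_linear : lead d u e \is 1.-homog.
    apply: (poly_eval_zform_homog uZ); rewrite -(psi_basic x e hZ).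
    by rewrite -(psi_change x y _ hZ).
  move=> ->; apply: eq_bigr => i _; congr (_ *: _).
  by rewrite (mcoeff_leadU ux) mxE.
have := gram_poly_lead x a b hZ; rewrite -/u -/c (eq_poly_eval lJ).
pose k := \sum_i \sum_j dual_gram Z B i j * (J a i * J b j).
have -> : \sum_i \sum_j dual_gram Z B i j *:
    ((lead d u a)^`M(i) * (lead d u b)^`M(j)) = k%:MP.
  rewrite (raddf_sum (@mpolyC _ _)); apply: eq_bigr => i _.
  rewrite (raddf_sum (@mpolyC _ _)); apply: eq_bigr => j _.
  by rewrite !lJ !zform_mderiv -mpolyCM -mul_mpolyC -mpolyCM.
move=> kE; exists (c^-1 * k); apply: (poly_eval_zform_inj (tf_jacobian ux)).
rewrite -/J poly_evalC alg_mpolyC mpolyCM mul_mpolyC kE scalerA mulVf ?scale1r;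
  first by [].
exact: ev_basic_top.
Qed.

Lemma const_gram_lead x Z a : g_homogeneous rG d g zeta Z -> const_gram x ->
  lead d (expansion q x Z) a = zform (jac q x *m invmx Z) a.
Proof.
move=> hZ cst; have [uZ _] := hZ; have ux := expansion_family x hZ.
pose h a b := ev q (inv_val (x top)) * ((gram_poly x a b)^`M(top))@_0.
rewrite (@lead_linear _ _ _ _ _ ux (dual_gram Z B) h).
- by rewrite -expansion_jac; apply: eq_bigr => i _; rewrite mxE.
- exact: (dual_gram_sym _ (gram_trmx I) (gram_unit I)).
- exact: (dual_gram_unit uZ (gram_trmx I) (gram_unit I)).
move=> e b; rewrite (gram_poly_lead x e b hZ) /h; have [k ->] := cst e b.
by rewrite poly_evalC alg_mpolyC mcoeffC eqxx mulr1 mpolyCM mul_mpolyC.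
Qed.

Lemma const_gram_lead_compatible x Z a : g_homogeneous rG d g zeta Z ->
  compatible x Z q -> const_gram x -> lead d (expansion q x Z) a = 'X_a.
Proof.
move=> hZ comp cst; rewrite (const_gram_lead a hZ cst) -zform1.
apply: (congr1 (fun Y => zform Y a)); rewrite -jac_dz.
by apply/matrixP => i j; rewrite !mxE comp.
Qed.

Lemma const_gram_good x : const_gram x -> good x g zeta q.
Proof.
(* In this basis, compatible with x, psi sends x^a to z^a exactly. *)
move=> cst; pose Z := jac q x.
have hZ : g_homogeneous rG d g zeta Z by apply: (jac_homogeneous I).
have [uZ _] := hZ.
have lX a : lead d (expansion q x Z) a = 'X_a.
  by apply: const_gram_lead_compatible (jac_compatible adm x) cst.
have psiX f : psi x Z q f = poly_eval (zform Z) (coord_poly x f).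
  by rewrite (psiE x f hZ) (eq_poly_eval lX) poly_eval_id.
exists x, Z; first exact: hZ.
split=> [a|f]; first by rewrite psiX coord_poly_coord poly_evalX zform_homog.
rewrite psiX => /(poly_eval_zform_homog uZ)/dhomog1_linear fE.
pose c := \row_a (coord_poly x f)@_U_(a).
exists c; split=> [|c' fc].
  rewrite -{1}(coord_polyK x f) {1}fE (linear_sum (poly_eval x)).
  by apply: eq_bigr => a _; rewrite linearZ /= poly_evalX mxE.
apply/rowP => a; rewrite mxE fc coord_poly_sum raddf_sum (bigD1 a) //=.
rewrite coord_polyZ coord_poly_coord mcoeffZ mcoeffXU eqxx mulr1 big1 ?addr0 //.
move=> b nba; rewrite coord_polyZ coord_poly_coord mcoeffZ mcoeffXU.
by rewrite (negPf nba) mulr0.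
Qed.

End TaylorExpansion.

(** * Metrics and Frobenius structures *)

Section CoordinateFields.
Context (K : numFieldType) (A : comAlgType K) (n : nat) (x : coordinates A n).
Implicit Types (X Y Z : derivation A) (f h : A) (a b : 'I_n).

Lemma der_coordE X f : X f = \sum_a X (x a) * pdx x a f.
Proof.
rewrite -{1}(coord_polyK x f) der_poly_eval; apply: eq_bigr => a _.
by rewrite mulrC.
Qed.

Lemma der_ext X Y : (forall a, X (x a) = Y (x a)) -> X = Y.
Proof.
move=> XY; apply: derP => f; rewrite der_coordE [RHS]der_coordE.
by apply: eq_bigr => a _; rewrite XY.
Qed.

Lemma der_addE X Y f : (X + Y) f = X f + Y f. Proof. by []. Qed.
Lemma der_oppE X f : (- X) f = - X f. Proof. by []. Qed.
Lemma der_scaleE h X f : (h *: X) f = h * X f. Proof. by []. Qed.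
Lemma lieE X Y f : lie X Y f = X (Y f) - Y (X f). Proof. by []. Qed.
Lemma der_sumE I (r : seq I) (F : I -> derivation A) f :
  (\sum_(i <- r) F i) f = \sum_(i <- r) F i f.
Proof. by elim/big_rec2: _ => // i y Y _ <-; rewrite der_addE. Qed.

Lemma pdx_coord a b : pdx x a (x b) = (a == b)%:R.
Proof. by rewrite /pdx /= coord_poly_coord mderivXU rmorph_nat eq_sym. Qed.

Lemma der_expand X : X = \sum_a X (x a) *: pdx x a.
Proof.
apply: derP => f; rewrite der_coordE der_sumE.
by apply: eq_bigr => a _.
Qed.

Lemma lie_pdx a b : lie (pdx x a) (pdx x b) = 0.
Proof.
apply: der_ext => e; rewrite lieE !pdx_coord.
by rewrite -!scaler_nat !der_alg subrr.
Qed.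

Context (J : metric A).

Lemma sharpE w Y : J (sharp J w) Y = pairing w Y.
Proof. by rewrite /sharp; case: cid => X [/= XE _]. Qed.

Lemma pairing_kd f X : pairing (kd f) X = X f.
Proof. by rewrite /pairing big_seq1 mul1r. Qed.

Lemma sharp_kd f Y : J (sharp J (kd f)) Y = Y f.
Proof. by rewrite sharpE pairing_kd. Qed.

(** Nondegeneracy is stated for differentials, so J(X, .) is first represented by the differential
    with coefficients J(X, d/dx^a). *)
Lemma metric_inj X Y : (forall Z, J X Z = J Y Z) -> X = Y.
Proof.
move=> XY; pose w : kahler A := [seq (J X (pdx x a), x a) | a : 'I_n].
have wE Z : J X Z = pairing w Z.
  rewrite {1}(der_expand Z) linear_sumr /pairing big_image /=.
  by apply: eq_bigr => a _; rewrite linearZr_LR /= mulrC.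
have [U [_ uniqU]] := metric_nondeg J w.
rewrite -(uniqU X wE); apply/esym/esym; apply: uniqU => Z.
by rewrite -XY wE.
Qed.

Lemma sharp_eval f : sharp J (kd f) = \sum_a pdx x a f *: sharp J (kd (x a)).
Proof.
apply: metric_inj => Z; rewrite sharp_kd linear_sumlz /= der_coordE.
by apply: eq_bigr => a _; rewrite linearZl_LR /= sharp_kd mulrC.
Qed.

Lemma sharp_expand X : X = \sum_a J X (pdx x a) *: sharp J (kd (x a)).
Proof.
apply: metric_inj => Z; rewrite {1}(der_expand Z) linear_sumr linear_sumlz.
apply: eq_bigr => a _; rewrite linearZr_LR linearZl_LR /= sharp_kd.
by rewrite mulrC.
Qed.

Lemma dual_metric_coord f h : dual_metric J (kd f) (kd h) =
  \sum_a \sum_b pdx x a f *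
    (pdx x b h * J (sharp J (kd (x a))) (sharp J (kd (x b)))).
Proof.
rewrite /dual_metric (sharp_eval f) linear_sumlz; apply: eq_bigr => a _.
rewrite linearZl_LR (sharp_eval h) linear_sumr /= mulr_sumr.
by apply: eq_bigr => b _; rewrite linearZr_LR.
Qed.

End CoordinateFields.

(** * Flatness of coordinates with constant dual metric *)

Section FlatCoordinates.
Context (K : numFieldType) (A : comAlgType K) (n : nat) (x : coordinates A n).
Implicit Types (X Y Z : derivation A) (f h : A) (a b c : 'I_n).

Lemma linear_fun_sum (U V : lmodType A) (L : U -> V) I (r : seq I)
    (k : I -> A) v :
  linear L -> L (\sum_(i <- r) k i *: v i) = \sum_(i <- r) k i *: L (v i).
Proof.
move=> lL; have L0 : L 0 = 0.
  by have := lL (-1) 0 0; rewrite scaler0 addr0 scaleN1r addNr.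
elim: r => [|i r IHr]; first by rewrite !big_nil.
by rewrite !big_cons lL IHr.
Qed.

Lemma alg_double_eq0 f : f = - f -> f = 0.
Proof.
move=> ff; have : (2%:R : K) *: f = 0.
  by rewrite scaler_nat mulr2n {1}ff addNr.
move=> /(congr1 ( *:%R 2%:R^-1)); rewrite scalerA mulVf ?pnatr_eq0 // scale1r.
by rewrite scaler0.
Qed.

Context (J : metric A) (nabla : derivation A -> derivation A -> derivation A).
Hypothesis lc : is_levi_civita J nabla.
Local Notation s a := (sharp J (kd (x a))).
Hypothesis constJ : forall a b, exists k : K, J (s a) (s b) = k%:A.

Let s_coord a b : s a (x b) = J (s b) (s a). Proof. by rewrite sharp_kd. Qed.

Lemma lie_sharp a b : lie (s a) (s b) = 0.
Proof.
apply: (der_ext (x := x)) => c; rewrite lieE !s_coord.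
by have [k ->] := constJ c a; have [l ->] := constJ c b; rewrite !der_alg subrr.
Qed.

(* The Christoffel symbols of the commuting fields s a are symmetric in the
   first two indices and antisymmetric in the last two. *)
Lemma nabla_sharp2 a b : nabla (s a) (s b) = 0.
Proof.
pose Gam a b c := J (nabla (s a) (s b)) (s c).
have sym i j k : Gam i j k = Gam j i k.
  rewrite /Gam; congr (J _ _); apply/eqP; rewrite -subr_eq0.
  by rewrite (nabla_torsion_free lc) lie_sharp.
have anti i j k : Gam i j k = - Gam i k j.
  apply/eqP; rewrite -addr_eq0 /Gam [X in _ + X]metric_sym -(nabla_metric lc).
  by have [e ->] := constJ j k; rewrite der_alg.
have G0 i j k : Gam i j k = 0.
  by apply: alg_double_eq0; rewrite {1}anti sym anti opprK sym anti sym.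
apply: (metric_inj x (J := J)) => Z.
rewrite (sharp_expand x J Z) linear_sumr [RHS]linear0l big1 // => c _.
by rewrite linearZr_LR /= -/(Gam a b c) G0 mulr0.
Qed.

Lemma nabla_sharp X b : nabla X (s b) = 0.
Proof.
rewrite (sharp_expand x J X) (linear_fun_sum _ _ _ (nabla_linear lc _)).
by rewrite big1 // => a _; rewrite nabla_sharp2 scaler0.
Qed.

Lemma nabla_form_coord a X Y : nabla_form nabla X (kd (x a)) Y = 0.
Proof.
rewrite /nabla_form !pairing_kd -(sharp_kd J (x a) Y).
rewrite -(sharp_kd J (x a) (nabla X Y)) (nabla_metric lc) nabla_sharp.
by rewrite linear0l add0r subrr.
Qed.

End FlatCoordinates.

(** * Consequences of the Frobenius axioms in coordinates *)

Section FrobeniusStructure.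
Context (K : numFieldType) (A : comAlgType K) (n : nat) (x : coordinates A
  n.+1).
Implicit Types (X Y Z : derivation A) (f h : A) (a b c i : 'I_n.+1).
Local Notation top := (@ord_max n).
Context (d : 'I_n.+1 -> nat) (J : metric A).
Context (mul : {bilinear derivation A -> derivation A -> derivation A}).
Context (e E : derivation A).
Context (nabla : derivation A -> derivation A -> derivation A).
Local Notation s a := (sharp J (kd (x a))).
Local Notation D := ((d top)%:R : K).

Hypothesis lc : is_levi_civita J nabla.
Hypothesis mulC : forall X Y, mul X Y = mul Y X.
Hypothesis invariance : forall X Y Z, J (mul X Y) Z = J X (mul Y Z).
Hypothesis potential : forall X Y Z,
  nabla X (mul Y Z) - mul Y (nabla X Z) - nabla Y (mul X Z) + mul X (nabla Y Z)
  - mul (lie X Y) Z = 0.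
Hypothesis unitP : forall X, mul e X = X.
Hypothesis unit_flat : forall X, nabla X e = 0.
Hypothesis euler_mul : forall X Y,
  lie E (mul X Y) - mul (lie E X) Y - mul X (lie E Y) = mul X Y.
Hypothesis euler_metric : forall X Y,
  E (J X Y) - J (lie E X) Y - J X (lie E Y) = (2 - (D - 2) / D) *: J X Y.
Hypothesis euler_coord : forall a, E (x a) = ((d a)%:R / D) *: x a.
Hypothesis d_gt0 : forall a, (0 < d a)%N.

Let D0 : D != 0. Proof. by rewrite pnatr_eq0 -lt0n. Qed.

(** The homogeneity of the product, applied to e o e = e. *)
Lemma lie_euler_unit : lie E e = - e.
Proof.
have := euler_mul e e; rewrite [mul (lie E e) e]mulC !unitP subrr sub0r => eE.
by rewrite -[in RHS]eE opprK.
Qed.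

Lemma euler_poly (P : {mpoly K[n.+1]}) m :
  (coord_poly x (E (poly_eval x P)))@_m = (wdeg d m)%:R / D * P@_m.
Proof.
have -> : coord_poly x (E (poly_eval x P)) =
    \sum_i ((d i)%:R / D) *: (P^`M(i) * 'X_i).
  apply: (poly_eval_inj (x := x)); rewrite coord_polyK der_poly_eval.
  rewrite (linear_sum (poly_eval x)); apply: eq_bigr => i _.
  by rewrite linearZ rmorphM /= poly_evalX euler_coord -scalerAr.
rewrite raddf_sum /= /wdeg natr_sum mulr_suml mulr_suml; apply: eq_bigr => i _.
rewrite mcoeffZ natrM -!mulrA; congr (_ * _); rewrite mulrCA; congr (_ * _).
have [mi|mi] := eqVneq (m i) 0%N; last first.
  rewrite [in LHS](mnm_split mi) mcoeffMX mcoeff_deriv addmC -mnm_split //.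
  by rewrite -[LHS]mulr_natl mnmBE mnm1E eqxx subn1 prednK ?lt0n.
rewrite mi mul0r; apply/eqP; rewrite mcoeff_eq0; apply/negP.
move=> /msuppM_le /allpairsP[[m1 m2] /= [_]].
rewrite mcoeff_msupp mcoeffX; case: (eqVneq U_(i)%MM m2) => [<-|_];
  last by rewrite eqxx.
by move=> _ /(congr1 (fun m : 'X_{1..n.+1} => m i));
  rewrite mi mnmDE mnm1E eqxx addn1.
Qed.

(** By [E, e] = - e, the function e(x^a) is homogeneous of weight d_a - d_n. It vanishes when this
    is negative and is a constant for a = n. *)
Lemma unit_coord : (forall a, a != top -> (d a < d top)%N) ->
  exists k : K, e = k%:A *: pdx x top.
Proof.
move=> lt_top; pose Q a := coord_poly x (e (x a)).
have Q0 a m : (Q a)@_m != 0 -> (wdeg d m + d top = d a)%N.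
  move=> nz; have := congr1 (fun X : derivation A => X (x a)) lie_euler_unit.
  rewrite lieE der_oppE euler_coord derZ -(coord_polyK x (e (x a))) -/(Q a).
  move=> /(congr1 (coord_poly x)) /(congr1 (mcoeff m)).
  rewrite -[- (_ *: _)]scaleN1r -[- poly_eval _ _]scaleN1r coord_polyD.
  rewrite !coord_polyZ mcoeffD !mcoeffZ euler_poly coord_poly_eval.
  rewrite (eq_poly_eval (coord_poly_coord x)) poly_eval_id mulrA -mulrDl.
  move=> /(mulIf nz) wE.
  apply/eqP; rewrite -(eqr_nat K) natrD -subr_eq0; apply/eqP.
  have -> : (wdeg d m)%:R + D - (d a)%:R =
      ((wdeg d m)%:R / D + -1 * ((d a)%:R / D) + 1) * D.
    by rewrite mulN1r mulrDl mulrBl !divfK // mul1r addrAC.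
  by rewrite wE addNr mul0r.
exists (Q top)@_0; apply: (der_ext (x := x)) => a.
rewrite der_scaleE pdx_coord -(coord_polyK x (e (x a))) -/(Q a).
have [->|na] := eqVneq a top.
  rewrite mulr1 -[RHS](poly_evalC x); congr poly_eval; apply/mpolyP => m.
  rewrite mcoeffC; have [->|nm] := eqVneq m 0%MM; first by rewrite mulr1.
  rewrite mulr0; apply/eqP; apply: contraT => nz.
  have w0 : wdeg d m = 0%N.
    by apply/eqP; rewrite -(eqn_add2r (d top)) (Q0 _ _ nz).
  by rewrite (wdeg_eq0 d_gt0 w0) eqxx in nm.
rewrite mulr0; suff -> : Q a = 0 by rewrite raddf0.
apply/mpolyP => m; rewrite mcoeff0; apply/eqP; apply: contraT => /Q0 wa.
by have := lt_top a na; rewrite -wa ltnNge leq_addl.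
Qed.

Lemma nabla_unit X : nabla e X = lie e X.
Proof. by rewrite -(nabla_torsion_free lc) unit_flat subr0. Qed.

(** Differentiate J(E, s_a o s_b) = Gm a b along e. The fields s_a are parallel along e because
    e(x^a) is constant; potentiality then makes s_a o s_b parallel along e too. Since nabla_e E =
    [e, E] = e, what remains is J(e, s_a o s_b) = J(s_a, s_b). *)
Lemma dual_metric_unit (Gm : 'I_n.+1 -> 'I_n.+1 -> A) :
  (forall a b, J E (mul (s a) (s b)) = Gm a b) ->
  (forall a, exists k : K, e (x a) = k%:A) ->
  forall a b, J (s a) (s b) = e (Gm a b).
Proof.
move=> inter cst a b; have es i : nabla e (s i) = 0.
  apply: (metric_inj x (J := J)) => Y; rewrite linear0l.
  have := nabla_metric lc e (s i) Y; rewrite !sharp_kd (nabla_unit Y) lieE.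
  have [k ->] := cst i; rewrite der_alg subr0 -[X in X = _]add0r.
  by move/addIr.
have eT : nabla e (mul (s a) (s b)) = 0.
  have := potential e (s a) (s b); rewrite -nabla_unit !es !unitP.
  by rewrite linear0r linear0l !subr0 subrK.
have eE : nabla e E = e.
  rewrite nabla_unit -[RHS]opprK -lie_euler_unit; apply: derP => f.
  by rewrite der_oppE !lieE opprB.
rewrite -inter (nabla_metric lc) eT linear0r addr0 eE -invariance unitP.
by [].
Qed.

Hypothesis flatx : forall X a, nabla X (pdx x a) = 0.
Local Notation p a := (pdx x a).

(** In flat coordinates, potentiality exchanges the differentiating index with the first index of
    the structure tensor; invariance and commutativity permute the others. *)
Lemma potential_symmetry a b c i :
  p c (J (mul (p a) (p b)) (p i)) = p i (J (mul (p a) (p b)) (p c)).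
Proof.
have swap u v w z : p u (J (mul (p v) (p w)) (p z)) = p v (J (mul (p u) (p w))
  (p z)).
  rewrite !(nabla_metric lc) !flatx !linear0r !addr0; congr (J _ _).
  have := potential (p u) (p v) (p w).
  rewrite lie_pdx !flatx !linear0r linear0l !subr0 addr0 => /eqP.
  by rewrite subr_eq0 => /eqP.
have rot u v w : J (mul (p u) (p v)) (p w) = J (mul (p w) (p v)) (p u).
  by rewrite [RHS]invariance [RHS]metric_sym (mulC (p v)).
by rewrite rot swap rot.
Qed.

Lemma lie_euler_pdx a : lie E (p a) = (- ((d a)%:R / D) : K)%:A *: p a.
Proof.
apply: (der_ext (x := x)) => b; rewrite lieE der_scaleE euler_coord derZ
  pdx_coord.
case: eqVneq => [->|_]; last by rewrite der0 scaler0 mulr0 subr0.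
by rewrite der1 sub0r mulr1 scaleNr.
Qed.

(** Let t = J(T, d/dx^c). The derivative of E contributes d_c / d_n times t, and that of T
    contributes E(t). Homogeneity of metric and product gives E(t) the factor 2 - (d_n - 2)/d_n + 1
    - (d_a + d_b + d_c)/d_n; in the sum d_c cancels. By duality of degrees the total is (d_{a*} +
    d_{b*} - 2)/d_n. *)
Lemma der_euler_gram a b c :
  p c (J E (mul (p a) (p b))) =
  ((D *+ 2 + 2 - (d a)%:R - (d b)%:R) / D) *: J (mul (p a) (p b)) (p c).
Proof.
set T := mul (p a) (p b).
have cE : nabla (p c) E = ((d c)%:R / D : K)%:A *: p c.
  rewrite {1}(der_expand x E).
  have nabla_sum r : nabla (p c) (\sum_(i <- r) E (x i) *: p i) =
      \sum_(i <- r) p c (E (x i)) *: p i.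
    elim: r => [|i r IHr]; last first.
      by rewrite !big_cons (nablaD lc) (nabla_leibniz lc) flatx scaler0 addr0
        IHr.
    rewrite !big_nil; apply: (addIr (nabla (p c) 0)).
    by rewrite -(nablaD lc) addr0 add0r.
  rewrite nabla_sum (bigD1 c) // big1 => [|i nic].
    by rewrite euler_coord derZ pdx_coord eqxx [LHS]addr0.
  rewrite euler_coord derZ pdx_coord eq_sym (negPf nic) scaler0 scale0r.
  by [].
(* Expanding E in coordinate fields, [potential_symmetry] exchanges the direction c of
   differentiation with each direction of E. *)
have cT : J E (nabla (p c) T) = E (J T (p c)).
  rewrite {1}(der_expand x E) linear_sumlz [RHS](der_coordE x).
  apply: eq_bigr => i _; apply: (etrans (linearZl_LR _ _ _ _)).
  apply: (congr1 ( *%R (E (x i)))); rewrite -(potential_symmetry a b c i)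
    (nabla_metric lc) flatx linear0r addr0.
  by rewrite metric_sym.
rewrite (nabla_metric lc) cE cT linearZl_LR /= -[J (p c) T]metric_sym.
have := euler_metric T (p c); have := euler_mul (p a) (p b).
rewrite -/T !lie_euler_pdx => /eqP; rewrite !subr_eq => /eqP ->.
move=> /eqP; rewrite !subr_eq => /eqP ->.
rewrite !(linearDl, linearZl_LR, linearZr_LR) /= -/T.
rewrite !mulr_algl; move: (J T (p c)) => t.
rewrite -[X in _ + (_ + (X + _ + _))](scale1r t) -!scalerDl.
apply: (congr1 ( *:%R^~ t)); rewrite mulr2n; move: D0; move: D => D1 D10.
by field.
Qed.

End FrobeniusStructure.

Section SaitoDubrovin.
Context (R : realType) (gT : finGroupType) (G : {group gT}) (n : nat).
Local Notation C := (R[i]).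
Context (rG : mx_representation C G n.+1).
Local Notation top := (@ord_max n).
Context (VR : real_form rG) (I : invariant_form VR).
Hypotheses (faithG : mx_faithful rG) (ntG : G :!=: 1%g).
Hypothesis irrG : mx_irreducible rG.
Context (d : 'I_n.+1 -> nat) (x : basic_invariants rG d).
Context (F : saito_dubrovin I x).
Implicit Types (a b c i j : 'I_n.+1).
Local Notation J := (sd_metric F).
Local Notation s a := (sharp J (kd (x a))).

Lemma euler_basic a : euler x (x a) = ((d a)%:R / (d top)%:R : C) *: x a.
Proof.
rewrite /euler der_sumE (bigD1 a) // big1 => [|i nia].
  by rewrite der_scaleE pdx_coord eqxx mulr1 [LHS]addr0.
by rewrite der_scaleE pdx_coord (negPf nia) mulr0.
Qed.

Lemma sd_intersection_basic a b :
  J (euler x) (sd_mul F (s a) (s b)) = IstarG I (x a) (x b).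
Proof.
rewrite sd_intersection /IstarG_form big_seq1 /= big_seq1 /=.
by rewrite mulr1 mul1r.
Qed.

Lemma sd_unit_basic : (forall a, 0 < d a)%N ->
  (forall a, a != top -> (d a < d top)%N) ->
  exists k : C, sd_unit F = k%:A *: pdx x top.
Proof.
move=> gt0 lt_top; apply: (unit_coord (sd_mulC F) (sd_unitP F) (sd_euler_mul
  F)).
- exact: euler_basic.
- exact: gt0.
- exact: lt_top.
Qed.

Lemma sd_dual_metric (k : C) a b : sd_unit F = k%:A *: pdx x top ->
  J (s a) (s b) = k *: poly_eval x (gram_poly I x a b)^`M(top).
Proof.
move=> eE; rewrite (@dual_metric_unit _ _ _ x _ _ _ _ _ (sd_levi_civita F)
  (sd_mulC F) (sd_invariance F) (sd_potential F) (sd_unitP F) (sd_unit_flat F)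
  (sd_euler_mul F) _ sd_intersection_basic).
  by rewrite eE der_scaleE mulr_algl.
move=> e; exists (k * (top == e)%:R).
by rewrite eE der_scaleE pdx_coord mulr_algl -scalerA scaler_nat.
Qed.

Lemma const_gram_dual_metric : (forall a, 0 < d a)%N ->
  (forall a, a != top -> (d a < d top)%N) -> const_gram I x ->
  forall a b, exists k : C, J (s a) (s b) = k%:A.
Proof.
move=> gt0 lt_top cst a b; have [k eE] := sd_unit_basic gt0 lt_top.
have [l lE] := cst a b; exists (k * l).
by rewrite (sd_dual_metric a b eE) lE poly_evalC scalerA.
Qed.

Lemma const_gram_flat : (forall a, 0 < d a)%N ->
  (forall a, a != top -> (d a < d top)%N) -> const_gram I x -> flat_invariants
    F.
Proof.
move=> gt0 lt_top cst a X Y.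
apply: (nabla_form_coord (sd_levi_civita F)).
exact: const_gram_dual_metric.
Qed.

End SaitoDubrovin.

Lemma gram_chain (K : numFieldType) n (M : 'M[K]_n) (p r : 'I_n -> {mpoly K[n]})
    (l : 'I_n -> 'I_n -> {mpoly K[n]}) :
  \sum_i \sum_j M i j *: ((\sum_a p a * l a i) * (\sum_b r b * l b j)) =
  \sum_a \sum_b p a * (r b * \sum_i \sum_j M i j *: (l a i * l b j)).
Proof.
pose t i j a b := p a * (r b * (M i j *: (l a i * l b j))).
transitivity (\sum_i \sum_j \sum_a \sum_b t i j a b).
  apply: eq_bigr => i _; apply: eq_bigr => j _.
  rewrite mulr_suml scaler_sumr; apply: eq_bigr => a _.
  rewrite mulr_sumr scaler_sumr; apply: eq_bigr => b _.
  by rewrite /t -!scalerAr; congr (_ *: _); ring.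
transitivity (\sum_a \sum_b \sum_i \sum_j t i j a b); last first.
  apply: eq_bigr => a _; apply: eq_bigr => b _.
  rewrite !mulr_sumr; apply: eq_bigr => i _.
  by rewrite !mulr_sumr.
under eq_bigr => i _ do rewrite exchange_big.
rewrite exchange_big; apply: eq_bigr => a _ /=.
under eq_bigr => i _ do rewrite exchange_big.
by rewrite exchange_big.
Qed.

(** * The isometry property of psi *)

Section Isometry.
Context (R : realType) (gT : finGroupType) (G : {group gT}) (n : nat).
Local Notation C := (R[i]).
Context (rG : mx_representation C G n.+1).
Local Notation top := (@ord_max n).
Context (VR : real_form rG) (I : invariant_form VR).
Hypotheses (faithG : mx_faithful rG) (ntG : G :!=: 1%g).
Hypothesis irrG : mx_irreducible rG.
Context (d : 'I_n.+1 -> nat) (g : gT) (zeta : C) (q : 'rV[C]_n.+1).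
Hypothesis adm : admissible rG d g zeta q.
Context (x : basic_invariants rG d) (F : saito_dubrovin I x).
Implicit Types (a b i j : 'I_n.+1).
Local Notation J := (sd_metric F).
Local Notation s a := (sharp J (kd (x a))).
Local Notation c := (ev q (inv_val (x top))).
Hypothesis unitF : sd_unit F = c%:A *: pdx x top.

Lemma sd_dual_metric_coord f1 f2 : dual_metric J (kd f1) (kd f2) =
  \sum_a \sum_b pdx x a f1 *
    (pdx x b f2 * (c *: poly_eval x (gram_poly I x a b)^`M(top))).
Proof.
apply: (etrans (dual_metric_coord x J f1 f2)).
apply: eq_bigr => a _; apply: eq_bigr => b _.
by rewrite (sd_dual_metric a b unitF).
Qed.

Lemma psi_isometry (y : basic_invariants rG d) (W : 'M[C]_n.+1) f1 f2 :
  g_homogeneous rG d g zeta W ->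
  Istar I (psi y W q f1) (psi y W q f2) =
  psi y W q (dual_metric J (kd f1) (kd f2)).
Proof.
move=> hW; have [uW _] := hW.
(* The metric is known in the coordinates x, so psi is rewritten from y to x. *)
pose psi_x f := psi_change I faithG ntG irrG adm x y f hW.
have psi_xE f := etrans (psi_x f) (psiE I faithG ntG irrG adm x f hW).
rewrite (psi_xE f1) (psi_xE f2) (psi_xE (dual_metric _ _ _)).
rewrite (Istar_zform W (gram_trmx I) (gram_unit I)).
apply: (congr1 (poly_eval (zform W))).
set L := lead d (expansion q x W).
have dL f i : (poly_eval L (coord_poly x f))^`M(i) =
    \sum_a poly_eval L (coord_poly x f)^`M(a) * (L a)^`M(i).
  exact: mderiv_poly_eval.
under eq_bigr => i _ do under eq_bigr => j _ do rewrite !dL.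
rewrite (gram_chain _ _ _ (fun a i => (L a)^`M(i))) sd_dual_metric_coord.
rewrite coord_poly_sum [RHS](linear_sum (poly_eval L)); apply: eq_bigr => a _.
rewrite coord_poly_sum [RHS](linear_sum (poly_eval L)); apply: eq_bigr => b _.
rewrite (gram_poly_lead I faithG ntG irrG adm x a b hW).
pose P1 := (coord_poly x f1)^`M(a); pose P2 := (coord_poly x f2)^`M(b).
pose Q := (gram_poly I x a b)^`M(top).
have -> : coord_poly x (pdx x a f1 * (pdx x b f2 * (c *: poly_eval x Q))) =
    P1 * (P2 * (c *: Q)).
  apply: (poly_eval_inj (x := x)); rewrite coord_polyK.
  by rewrite !poly_evalM poly_evalZ.
rewrite 2!(rmorphM (poly_eval L)).
apply: (congr1 (fun t => poly_eval L P1 * (poly_eval L P2 * t))).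
exact: (esym (poly_eval_scalable L _ Q)).
Qed.

End Isometry.

(** * Explicit formulas in good compatible coordinates *)

Section Formulas.
Context (R : realType) (gT : finGroupType) (G : {group gT}) (n : nat).
Local Notation C := (R[i]).
Context (rG : mx_representation C G n.+1).
Local Notation top := (@ord_max n).
Context (VR : real_form rG) (I : invariant_form VR).
Local Notation B := (I : 'M[C]_n.+1).
Hypotheses (faithG : mx_faithful rG) (ntG : G :!=: 1%g).
Hypothesis irrG : mx_irreducible rG.
Context (d : 'I_n.+1 -> nat) (g : gT) (zeta : C) (q : 'rV[C]_n.+1).
Hypothesis adm : admissible rG d g zeta q.
Context (x : basic_invariants rG d) (Z : 'M[C]_n.+1).
Hypothesis hZ : g_homogeneous rG d g zeta Z.
Hypothesis compat : compatible x Z q.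
Implicit Types (a b i j : 'I_n.+1) (m : 'X_{1..n.+1}).
Local Notation c := (ev q (inv_val (x top))).

Let ge2 := adm_ge2 I faithG ntG irrG adm.
Let gt0 := adm_gt0 I faithG ntG irrG adm.
Let dual := degree_duality I faithG ntG irrG adm.
Let lt_top := degree_lt_top I faithG ntG irrG adm.
Let uZ : Z \in unitmx. Proof. by case: hZ. Qed.
Let c0 : c != 0. Proof. exact: (ev_basic_top I faithG ntG irrG adm). Qed.

Lemma dzm0 f : dzm Z 0%MM f = f.
Proof.
by apply: (taylor_inj (q := 0) uZ); rewrite -taylor_mderivm mderivm0m.
Qed.

Lemma dzmU i f : dzm Z U_(i)%MM f = dz Z i f.
Proof. by rewrite -[U_(i)%MM]add0m -(dzm_dz 0 uZ) dzm0. Qed.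

Lemma dz_homog i D f : f \is D.+1.-homog -> dz Z i f \is D.-homog.
Proof.
by move=> hf; apply: rpred_sum => j _; apply: rpredZ; apply: dhomog_mderiv.
Qed.

Lemma ev_euler_dz D f : f \is D.-homog ->
  \sum_a ev q (zform Z a) * ev q (dz Z a f) = D%:R * ev q f.
Proof.
move=> /sum_var_mderiv /(congr1 (ev q)).
rewrite {2}/ev mevalZ -/(ev q f) => <-.
transitivity (\sum_i q 0 i * ev q f^`M(i)); last first.
  by rewrite /ev (raddf_sum (meval _)); apply: eq_bigr => i _;
    rewrite /= mevalM mevalXU.
have evz a : ev q (zform Z a) = \sum_i Z a i * q 0 i.
  rewrite /ev /zform (raddf_sum (meval _)).
  by apply: eq_bigr => i _; rewrite /= mevalZ mevalXU.
under eq_bigr => a _ do rewrite evz mulr_suml.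
rewrite exchange_big; apply: eq_bigr => i _ /=.
rewrite (mderiv_dz uZ i f) /ev (raddf_sum (meval _)) mulr_sumr.
by apply: eq_bigr => a _; rewrite /= mevalZ mulrCA mulrA.
Qed.

(** Euler's identity for x^a at q, where compatibility leaves a single term. *)
Lemma ev_zform a : ev q (zform Z a) = (d a)%:R * ev q (inv_val (x a)).
Proof.
rewrite -(ev_euler_dz (basic_homog x a)) (bigD1 a) //= compat eqxx mulr1.
rewrite big1 ?addr0 // => b nba.
by rewrite compat eq_sym (negPf nba) mulr0.
Qed.

(** Euler's identity at q for the derivative of x^n in z^n, which has degree d_n - 1 and value 1.
    Only z^n(q) = d_n x^n(q) is nonzero among the coordinates of q, so d_n x^n(q) times the second
    derivative is d_n - 1. *)
Lemma inv_ev_basic_top :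
  c^-1 = (d top)%:R / ((d top)%:R - 1) *
         ev q (dzm Z (U_(top) + U_(top)) (x top)).
Proof.
have hT : inv_val (x top) \is (d top - 1).+1.-homog.
  by rewrite subn1 prednK ?gt0 // basic_homog.
have := ev_euler_dz (dz_homog top hT); rewrite compat eqxx mulr1.
rewrite (bigD1 top) //= big1 ?addr0 => [|a na]; last first.
  by rewrite ev_zform (ev_basic0 I faithG ntG irrG adm x hZ na) mulr0 mul0r.
rewrite ev_zform -(dzm_dz q uZ) dzmU natrB ?gt0 // => dE.
have d1 : (d top)%:R - 1 != 0 :> C.
  by rewrite subr_eq0 pnatr_eq1 gtn_eqF ?ge2.
have d0 : (d top)%:R != 0 :> C by rewrite pnatr_eq0 -lt0n gt0.
move: dE d1 d0 c0; move: (ev q (dz _ _ _)) => t; move: c => k.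
move: (d top)%:R => D dE d1 d0 k0.
have -> : t = (D - 1) / (D * k) by rewrite -dE; field; rewrite k0 d0.
by field; rewrite k0 d1 d0.
Qed.

Lemma taylor_coefficient a b m : wdeg d m = (d a + d b - 2)%N ->
  dzm Z m (dz Z (rev_ord b) (x a)) = dzm Z (m + U_(rev_ord b)) (x a) /\
  wdeg d (m + U_(rev_ord b))%MM = (d a + d top)%N.
Proof.
move=> wm; split; first exact: (dzm_dz q uZ).
by rewrite wdegD wdegU wm; have := dual b; have := ge2 a; have := ge2 b; lia.
Qed.

Hypothesis orthoZ : forall a b, dual_form I (row a Z) (row b Z) = (a + b ==
  n)%N%:R.
Hypothesis cst : const_gram I x.

Lemma rev_ordP a b : (a + b == n)%N = (rev_ord a == b).
Proof.
rewrite -val_eqE /= subSS; have := ltn_ord a; have := ltn_ord b.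
by move=> lb la; apply/eqP/eqP; lia.
Qed.

Lemma dual_gram_rev a b : dual_gram Z B a b = (rev_ord a == b)%:R.
Proof. by rewrite mxE orthoZ rev_ordP. Qed.

Let u := expansion q x Z.
Let ux : taylor_family d u c.
Proof. exact: (expansion_family I faithG ntG irrG adm x hZ). Qed.
Let lX a : lead d u a = 'X_a.
Proof. exact: (const_gram_lead_compatible faithG ntG irrG adm a hZ compat cst).
  Qed.
Let wM i j : dual_gram Z B i j != 0 -> (d i + d j = d top + 2)%N.
Proof. exact: (dual_gram_weight faithG ntG irrG adm hZ). Qed.
Let wP a b := gram_poly_weight faithG ntG irrG adm (I := I) (x := x) (a := a)
  (b := b).
Let eP a b := gram_poly_expansion I q x a b uZ.

Lemma gram_poly_top a b :
  (gram_poly I x a b)^`M(top) = (c^-1 * (a + b == n)%N%:R)%:MP.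
Proof.
rewrite rev_ordP -dual_gram_rev.
exact: (mderiv_top_gram ux lX wM (@wP a b) (eP a b)).
Qed.

Lemma gram_poly_next a b : gram_poly I x a b =
  wpart d 2 (d a + d b)
    (taylor Z q (dz Z (rev_ord b) (x a) + dz Z (rev_ord a) (x b))).
Proof.
rewrite [LHS](lead_gram_next ux lX wM (@wP a b) (eP a b)).
apply: (congr1 (wpart d 2 (d a + d b))).
rewrite /taylor (raddfD (poly_eval _)) addrC; apply: (congr2 +%R).
  rewrite (bigD1 (rev_ord b)) // big1 => [|i ni].
    rewrite dual_gram_rev rev_ordK eqxx scale1r [LHS]addr0.
    exact: taylor_mderiv.
  rewrite dual_gram_rev (_ : _ == _ = false) ?scale0r //.
  by apply: contraNF ni => /eqP <-; rewrite rev_ordK.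
rewrite (bigD1 (rev_ord a)) // big1 => [|j nj].
  rewrite dual_gram_rev eqxx scale1r [LHS]addr0.
  exact: taylor_mderiv.
by rewrite dual_gram_rev eq_sym (negPf nj) scale0r.
Qed.

(** Coefficients are compared: by [gram_poly_top] the variable x^n occurs only as the linear
    monomial, and the coefficients free of it are the Taylor coefficients selected by
    [gram_poly_next]. *)
Lemma IstarG_formula a b : IstarG I (x a) (x b) =
  ((a + b == n)%N%:R / c) *: x top
  + \sum_(m : 'X_{1..n.+1 < (d a + d b - 2).+1} |
          (m top == 0)%N && (wdeg d m == d a + d b - 2)%N)
      ((mnm_fact m)%:R^-1
       * ev q (dzm Z m (dz Z (rev_ord b) (x a) + dz Z (rev_ord a) (x b))))
      *: \prod_i x i ^+ m i.
Proof.
pose p m := (m top == 0)%N && (wdeg d m == d a + d b - 2)%N.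
pose f m := (mnm_fact m)%:R^-1
  * ev q (dzm Z m (dz Z (rev_ord b) (x a) + dz Z (rev_ord a) (x b))).
pose Q : {mpoly C[n.+1]} := ((a + b == n)%N%:R / c) *: 'X_top +
  \sum_(m : 'X_{1..n.+1 < (d a + d b - 2).+1} | p m) f m *: 'X_[m].
suff PQ : gram_poly I x a b = Q.
  rewrite -[LHS](coord_polyK x) -/(gram_poly I x a b) PQ.
  rewrite /Q poly_evalD poly_evalZ poly_evalX; apply: (congr1 (+%R _)).
  rewrite (linear_sum (poly_eval x)); apply: eq_bigr => m _.
  apply: (etrans (poly_evalZ x (f m) 'X_[m])).
  exact: (congr1 ( *:%R (f m)) (poly_evalXm x m)).

apply/mpolyP => m; rewrite /Q mcoeffD mcoeffZ mcoeffX.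
rewrite (@mcoeff_bounded_sum _ _ _ p f) /p.
have [m0|mt] := eqVneq (m top) 0%N.
  case: (eqVneq U_(top)%MM m) => [Um|_]; first by move: m0;
    rewrite -Um mnm1E eqxx.
  rewrite mulr0 add0r /=; case: (eqVneq (wdeg d m) _) => [wm|wm] /=.
    rewrite ltnS -wm mdeg_le_wdeg // gram_poly_next mcoeff_wpart.
    rewrite (_ : _ == _)%N; last by rewrite wm; apply/eqP; have := ge2 a; lia.
    by rewrite mcoeff_taylor.
  apply/eqP; rewrite mcoeff_eq0; apply: contra wm => /(@wP a b) wm.
  by rewrite -wm addnK.
rewrite addr0; case: (eqVneq U_(top)%MM m) => [<-|nm].
  have := congr1 (mcoeff 0%MM) (gram_poly_top a b).
  rewrite mcoeff_deriv add0m mnm0E mulr1n mcoeffC eqxx !mulr1 => ->.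
  by rewrite mulrC.
rewrite mulr0; apply/eqP; rewrite mcoeff_eq0; apply/negP => mP.
have [m0|mU] := mderiv_const_supp (gram_poly_top a b) mP.
  by rewrite m0 eqxx in mt.
by rewrite mU eqxx in nm.
Qed.

Context (F : saito_dubrovin I x).
Hypothesis unitF : sd_unit F = c%:A *: pdx x top.
Local Notation J := (sd_metric F).
Local Notation s a := (sharp J (kd (x a))).

(** The normalisation of the unit by x^n(q) cancels the factor 1/x^n(q) in [gram_poly_top]. *)
Lemma sharp_gram a b : J (s a) (s b) = (a + b == n)%N%:R.
Proof.
rewrite (sd_dual_metric a b unitF) gram_poly_top poly_evalC scalerA.
by rewrite mulrA mulfV ?c0 // mul1r scaler_nat.
Qed.

Lemma sharp_pdx a : s a = pdx x (rev_ord a).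
Proof.
apply: (der_ext (x := x)) => b.
by rewrite pdx_coord -rev_ordP -(sharp_kd J) sharp_gram addnC.
Qed.

Lemma metric_formula a b : J (pdx x a) (pdx x b) = (a + b == n)%N%:R.
Proof.
rewrite -(rev_ordK a) -(rev_ordK b) -!sharp_pdx sharp_gram !rev_ordP !rev_ordK.
by rewrite -(inj_eq rev_ord_inj) rev_ordK.
Qed.

Lemma nabla_pdx X a : sd_nabla F X (pdx x a) = 0.
Proof.
rewrite -(rev_ordK a) -sharp_pdx; apply: (nabla_sharp (sd_levi_civita F)).
exact: (const_gram_dual_metric F gt0 lt_top cst).
Qed.

(** As d/dx^a is the sharp of dx^{a*}, the function I^*_G(dx^{a*}, dx^{b*}) is J(E, T) for the
    product T of the two fields. The coefficient of d/dx^e in T is J(T, d/dx^{e*}), which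
    [der_euler_gram] recovers from the derivative of J(E, T) along x^{e*}. *)
Lemma mul_formula a b : sd_mul F (pdx x a) (pdx x b) =
  \sum_e
    pdx x (rev_ord e)
      (((d top)%:R / ((d (rev_ord a))%:R + (d (rev_ord b))%:R - 2) : C)
       *: IstarG I (x (rev_ord a)) (x (rev_ord b)))
    *: pdx x e.
Proof.
rewrite [LHS](der_expand x); apply: eq_bigr => e _.
apply: (congr1 (fun h => h *: pdx x e)).
rewrite derZ -(sd_intersection_basic F) !sharp_pdx !rev_ordK.
rewrite (der_euler_gram (sd_levi_civita F) (sd_mulC F) (sd_invariance F)
  (sd_potential F) (sd_euler_mul F) (sd_euler_metric F) (euler_basic x) gt0
  nabla_pdx).
rewrite scalerA metric_sym -sharp_pdx sharp_kd -[LHS]scale1r.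
apply: (congr1 (fun k => k *: _)).
have dE i : (d (rev_ord i))%:R = (d top)%:R + 2 - (d i)%:R :> C.
  by rewrite -(natrD _ (d top) 2) -(dual i) addnC natrD addrK.
have d0 : (d top)%:R != 0 :> C by rewrite pnatr_eq0 -lt0n gt0.
have nz : (d (rev_ord a))%:R + (d (rev_ord b))%:R - 2 != 0 :> C.
  rewrite -natrD -natrB ?pnatr_eq0 -?lt0n ?subn_gt0.
    by have := ge2 (rev_ord a); have := ge2 (rev_ord b); lia.
  by have := ge2 (rev_ord a); have := ge2 (rev_ord b); lia.
rewrite -mulrA [_ / _ in RHS]mulrC; move: nz; rewrite !dE => nz.
rewrite -[LHS](mulfV (mulf_neq0 d0 nz)).
by field; rewrite d0 nz.
Qed.

End Formulas.

Theorem corollary8p5 (R : realType) (gT : finGroupType) (G : {group gT})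
    (n : nat) (rG : mx_representation R[i] G n.+1)
    (faithful_G : mx_faithful rG) (nontrivial_G : G :!=: 1%g)
    (reflection_G : generated_by_reflections rG)
    (VR : real_form rG) (irreducible_G : mx_irreducible rG)
    (I : invariant_form VR) (d : 'I_n.+1 -> nat)
    (g : gT) (zeta : R[i]) (q : 'rV[R[i]]_n.+1)
    (adm : admissible rG d g zeta q) :
  (* (i) *)
  (forall (Z : 'M[R[i]]_n.+1) (x : basic_invariants rG d)
      (F : saito_dubrovin I x),
    g_homogeneous rG d g zeta Z ->
    (forall a b, dual_form I (row a Z) (row b Z) = (a + b == n)%N%:R) ->
    good x g zeta q -> compatible x Z q ->
    sd_unit F = (ev q (x ord_max))%:A *: pdx x ord_max ->
    [/\ forall a b, sd_metric F (pdx x a) (pdx x b) = (a + b == n)%N%:R,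
        forall a b, sd_mul F (pdx x a) (pdx x b) =
          \sum_c
            pdx x (rev_ord c)
              (((d ord_max)%:R
                / ((d (rev_ord a))%:R + (d (rev_ord b))%:R - 2) : R[i])
               *: IstarG I (x (rev_ord a)) (x (rev_ord b)))
            *: pdx x c,
        forall a b, IstarG I (x a) (x b) =
          ((a + b == n)%N%:R / ev q (x ord_max)) *: x ord_max
          + \sum_(m : 'X_{1..n.+1 < (d a + d b - 2).+1} |
                  (m ord_max == 0)%N && (wdeg d m == d a + d b - 2)%N)
              ((mnm_fact m)%:R^-1
               * ev q (dzm Z m (dz Z (rev_ord b) (x a)
                                + dz Z (rev_ord a) (x b))))
              *: \prod_i x i ^+ m i,
        (* every derivative in the last formula is a Taylor coefficient
           d^c x^a / d z^c (q) with d . c = d_a + d_n *)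
        forall a b (m : 'X_{1..n.+1}), wdeg d m = (d a + d b - 2)%N ->
          dzm Z m (dz Z (rev_ord b) (x a)) = dzm Z (m + U_(rev_ord b)) (x a)
          /\ wdeg d (m + U_(rev_ord b)) = (d a + d ord_max)%N
      & (* and so is the constant 1 / x^n(q), up to a rational factor *)
        (ev q (x ord_max))^-1 =
          (d ord_max)%:R / ((d ord_max)%:R - 1)
          * ev q (dzm Z (U_(ord_max) + U_(ord_max)) (x ord_max))])
  /\
  (* (ii) *)
  ((forall g' zeta' q', admissible rG d g' zeta' q' ->
     forall x : basic_invariants rG d, good x g' zeta' q' ->
     forall F : saito_dubrovin I x, flat_invariants F)
   /\
   (forall g1 zeta1 q1 g2 zeta2 q2,
     admissible rG d g1 zeta1 q1 -> admissible rG d g2 zeta2 q2 ->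
     forall x : basic_invariants rG d,
     good x g1 zeta1 q1 <-> good x g2 zeta2 q2))
  /\
  (* (iii) *)
  (forall (Z : 'M[R[i]]_n.+1) (x : basic_invariants rG d)
      (F : saito_dubrovin I x),
    g_homogeneous rG d g zeta Z ->
    (forall a b, dual_form I (row a Z) (row b Z) = (a + b == n)%N%:R) ->
    good x g zeta q -> compatible x Z q ->
    sd_unit F = (ev q (x ord_max))%:A *: pdx x ord_max ->
    forall (y : basic_invariants rG d) (W : 'M[R[i]]_n.+1),
    g_homogeneous rG d g zeta W ->
    forall f1 f2 : invariants rG,
      Istar I (psi y W q f1) (psi y W q f2)
      = psi y W q (dual_metric (sd_metric F) (kd f1) (kd f2))).
Proof.
have gt0 := adm_gt0 I faithful_G nontrivial_G irreducible_G adm.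
have lt_top := degree_lt_top I faithful_G nontrivial_G irreducible_G adm.
split; last split.
- move=> Z x F hZ ortho gd comp unitF.
  have cst := good_const_gram I faithful_G nontrivial_G irreducible_G adm gd.
  split.
  + move=> a b.
    exact: (metric_formula faithful_G nontrivial_G irreducible_G adm hZ comp
      ortho cst unitF).
  + move=> a b.
    exact: (mul_formula faithful_G nontrivial_G irreducible_G adm hZ comp
      ortho cst unitF).
  + move=> a b.
    exact: (IstarG_formula faithful_G nontrivial_G irreducible_G adm hZ comp
      ortho cst).
  + move=> a b m.
    exact: (taylor_coefficient I faithful_G nontrivial_G irreducible_G adm x
      hZ).
  + exact: (inv_ev_basic_top I faithful_G nontrivial_G irreducible_G adm hZ
    comp).
- split=> [g' zeta' q' adm' x gd F|g1 zeta1 q1 g2 zeta2 q2 adm1 adm2 x].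
    apply: const_gram_flat => //.
    exact: (good_const_gram I faithful_G nontrivial_G irreducible_G adm' gd).
  have goodP g' zeta' q' (adm' : admissible rG d g' zeta' q') :
      good x g' zeta' q' <-> const_gram I x.
    split.
      exact: (good_const_gram I faithful_G nontrivial_G irreducible_G adm').
    exact: (const_gram_good (I := I) faithful_G nontrivial_G irreducible_G
      adm').
  exact: (iff_trans (goodP _ _ _ adm1) (iff_sym (goodP _ _ _ adm2))).
- move=> Z x F _ _ _ _ unitF y W hW f1 f2.
  exact: (psi_isometry faithful_G nontrivial_G irreducible_G adm unitF).
Qed.
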